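(* Let $q\ge 4$ be a prime power and let $0<n<m$ be integers with $\gcd(m,n,q-1)=1$. If $\gcd(m-n,q-1)>2q(\log\log q)/\log q$, then there exists $a\in\mathbb{F}_q^*$ such that $x^m+ax^n$ permutes $\mathbb{F}_q$. Further, letting $T$ denote the number of values $a\in\mathbb{F}_q$ for which $x^m+ax^n$ permutes $\mathbb{F}_q$, and putting $r:=(q-1)/\gcd(m-n,q-1)$, we have \[ \frac{q-2\sqrt{q}+1}{r^{r-1}} - (r-3)\sqrt{q} - 2 \le \frac{T}{(r-1)!} \le \frac{q+2\sqrt{q}+1}{r^{r-1}} + (r-3)\sqrt{q}. \]
   Context: $\log$ denotes the natural logarithm. A polynomial $f\in\mathbb{F}_q[x]$ is said to permute $\mathbb{F}_q$ if the map $\alpha\mapsto f(\alpha)$ is a bijection $\mathbb{F}_q\to\mathbb{F}_q$. *)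

(* Defs.v *)
From mathcomp Require Import all_boot all_order all_algebra.
From mathcomp Require Import boolp reals exp.

Set Implicit Arguments.
Unset Strict Implicit.
Unset Printing Implicit Defensive.

Import GRing.Theory Num.Theory.

Local Open Scope ring_scope.

Definition permutes (F : finFieldType) (f : {poly F}) : Prop :=
  bijective (fun x : F => f.[x]).

Definition num_permuting (F : finFieldType) (m n : nat) : nat :=
  #|[pred a : F | `[< permutes ('X^m + a *: 'X^n) >]]|.

(* Main.v *)
Require Import Defs.
From mathcomp Require Import all_boot all_order all_algebra.
From mathcomp Require Import boolp reals exp.
From mathcomp Require Import cyclic perm fraction generic_quotient all_field.
From mathcomp Require Import qpoly qfpoly.
From mathcomp Require Import zify ring lra.

(** Put [s = gcd(m - n, q - 1)], [r = (q - 1) / s] and [e = (m - n) / s].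
    Since [gcd(n, s) = 1], the binomial [x^m + a x^n] permutes [F_q] iff
    [u |-> u^n (u^e + a)^s] permutes the group [mu_r] of [r]-th roots of unity.
    For a permutation [pi] of [mu_r], the number of [a] for which this map is a
    scalar multiple of [pi] is expanded in multiplicative characters; working up
    to scalars leaves only products [prod_u chi^(J u) (u^e + a)] with [r] dividing
    [sum_u J u].  If such a product has [k > 0] nontrivial factors, then the
    character sum, completed by the value 1 at infinity, is at most
    [(k - 2) sqrt q] in absolute value, and summing [k - 2] over all [J] gives
    the constants of the theorem.

    That bound is Weil's.  The generating polynomial [L] of the sums of the
    character over monic polynomials of degree [n] has degree less than [k],
    [L(0) = 1] and [L(1) = 0], and its reciprocal roots have power sums equal,
    up to sign, to the character sums over the extensions [F_(q^n)].  It
    therefore suffices to bound the latter by [O(q^(n/2))] for even [n], which is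
    done by Stepanov's method in the form given to it by Bombieri: on the curve
    [y^d = f(x)] over [F_(P^2)] one constructs a function whose [P]-th power
    vanishes at all the rational points to be counted. *)

Set Implicit Arguments.
Unset Strict Implicit.
Unset Printing Implicit Defensive.

Import Order.TTheory GRing.Theory Num.Theory.
Local Open Scope ring_scope.

(** * Irreducibility of Kummer polynomials *)

(** Only even extensions are treated because Stepanov's construction needs a square number [P ^ 2]
    of elements: raising to the [P]-th power twice must return a point to itself, up to a constant
    factor on [y]. It also needs a point at which functions on the curve can be expanded. This is
    the origin, with a branch [y = Y(x)] of the [d]-th root of [f]; hence the ramification points,
    here the [u ^ e], are nonzero and [f] is scaled to [f(0) = 1]. The extensions themselves are
    never built. A point is represented by its minimal polynomial, weighted by its degree, and
    evaluated in the residue field of that polynomial. Working up to scalars makes the character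
    trivial on constants, that is, unramified at infinity. This gives [L(1) = 0] and lowers the
    constant of the bound from [k - 1] to [k - 2]. For existence, the hypothesis on the gcd yields
    [r ^ r < sqrt q] when [r >= 2]. The lower bound then exceeds 1, so that [T > (r - 1)!]; two
    permuting values exist and one of them is nonzero. *)

Lemma irreducible_factor_exists (K : fieldType) (p : {poly K}) :
  (1 < size p)%N ->
  exists g, [/\ g \is monic, irreducible_poly g & g %| p].
Proof.
have [n] := ubnP (size p); elim: n p => // n IHn p lepn p_gt1.
have p_neq0 : p != 0 by rewrite -size_poly_gt0 ltnW.
have [p_irr|p_red] := EM (irreducible_poly p).
  exists ((lead_coef p)^-1 *: p); split.
  - by rewrite monicE lead_coefZ mulVf ?lead_coef_eq0.
  - split; first by rewrite size_scale ?invr_eq0 ?lead_coef_eq0.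
    move=> q q1; rewrite dvdpZr ?invr_eq0 ?lead_coef_eq0// => /p_irr.2 => /(_ q1).
    by move=> /eqp_trans; apply; rewrite eqp_sym eqp_scale ?invr_eq0 ?lead_coef_eq0.
  - by rewrite dvdpZl ?invr_eq0 ?lead_coef_eq0.
have [q [q1 qp qNp]] : exists q : {poly K}, [/\ size q != 1, q %| p & ~~ (q %= p)].
  apply: contrapT => H; apply: p_red; split=> // q q1 qp.
  by apply: contrapT => /negP nqp; apply: H; exists q.
have q_neq0 : q != 0 by apply: contraNneq p_neq0 => q0; rewrite q0 dvd0p in qp.
have q_gt1 : (1 < size q)%N by rewrite ltn_neqAle eq_sym q1 size_poly_gt0.
have qltp : (size q < size p)%N.
  rewrite ltn_neqAle dvdp_leq// andbT; apply: contra qNp => /eqP eqs.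
  by rewrite -dvdp_size_eqp// eqs.
have [|g [gm gi gq]] := IHn q _ q_gt1; first exact: leq_trans qltp _.
by exists g; split=> //; exact: dvdp_trans qp.
Qed.

Lemma coprimep_irreducible (K : fieldType) (p q : {poly K}) :
  irreducible_poly p -> irreducible_poly q -> ~~ (p %= q) -> coprimep p q.
Proof.
move=> [p1 pi] [q1 qi]; apply: contraNT => Ncop.
have gN1 : size (gcdp p q) != 1 by [].
have := pi _ gN1 (dvdp_gcdl _ _); rewrite eqp_sym => /eqp_trans; apply.
exact: qi _ gN1 (dvdp_gcdr _ _).
Qed.

Lemma size_comp_scaleX (K : fieldType) (p : {poly K}) (c : K) :
  c != 0 -> size (p \Po (c *: 'X)) = size p.
Proof.
by move=> c0; rewrite size_comp_poly2// size_scale// size_polyX.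
Qed.

Lemma coef_comp_scaleX (K : fieldType) (p : {poly K}) (c : K) i :
  (p \Po (c *: 'X))`_i = p`_i * c ^+ i.
Proof.
rewrite comp_polyE coef_sum.
under eq_bigr => j _ do rewrite exprZn scalerA coefZ coefXn.
have [ip|ip] := ltnP i (size p).
  rewrite (bigD1 (Ordinal ip))//= eqxx mulr1 big1 ?addr0// => j /eqP ji.
  case: eqP => [ij|]; last by rewrite mulr0.
  by case: ji; apply: val_inj.
rewrite nth_default// mul0r big1// => j _.
by rewrite gtn_eqF ?mulr0// (leq_trans (ltn_ord j)).
Qed.

Lemma comp_scaleXK (K : fieldType) (p : {poly K}) (a b : K) :
  (p \Po (a *: 'X)) \Po (b *: 'X) = p \Po ((a * b) *: 'X).
Proof.
apply/polyP => i; rewrite !coef_comp_scaleX exprMn; ring.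
Qed.


Lemma dvdp_prod_coprime (K : fieldType) (I : eqType) (s : seq I) (g : I -> {poly K}) p :
  uniq s -> {in s &, forall i j, i != j -> coprimep (g i) (g j)} ->
  {in s, forall i, g i %| p} -> \prod_(i <- s) g i %| p.
Proof.
elim: s => [|i s IHs] /=; first by rewrite big_nil dvd1p.
move=> /andP[is_ us] cop dvd; rewrite big_cons Gauss_dvdp.
  rewrite dvd ?mem_head// IHs// => [j k js ks|j js].
    by apply: cop; rewrite inE ?js ?ks orbT.
  by apply: dvd; rewrite inE js orbT.
rewrite big_seq; apply: (big_ind (coprimep (g i))) => [|x y cx cy|j js].
- exact: coprimep1.
- by rewrite coprimepMr cx.
- by apply: cop; rewrite ?inE ?eqxx ?js ?orbT//; apply: contraNneq is_ => ->.
Qed.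

(* Let [G] be an irreducible monic factor and [t] least such that [G(z^t X)] is
   proportional to [G].  The [G(z^i X)], [i < t], are coprime factors, so
   [t deg G <= d]; comparing coefficients in [G(z^t X) ~ G] then forces
   [t deg G = d] and [G = X^(d/t) + G(0)], which makes [f] a [t]-th power. *)
Lemma XnsubC_irreducible (K : fieldType) (d : nat) (z f : K) :
  d.-primitive_root z ->
  (forall t u, (t %| d)%N -> f = u ^+ t -> t = 1%N) ->
  irreducible_poly ('X^d - f%:P).
Proof.
move=> zP fP; have d_gt0 := prim_order_gt0 zP.
set p := 'X^d - f%:P.
have szp : size p = d.+1 by rewrite size_XnsubC.
have z0 : z != 0.
  apply/eqP => z0; have := prim_expr_order zP.
  by rewrite z0 expr0n gtn_eqF// => /eqP; rewrite eq_sym oner_eq0.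
have [G [Gm Gi Gp]] : exists g, [/\ g \is monic, irreducible_poly g & g %| p].
  by apply: irreducible_factor_exists; rewrite szp ltnS.
have G_neq0 := monic_neq0 Gm.
pose k := (size G).-1.
have k_gt0 : (0 < k)%N by rewrite /k -ltnS prednK ?size_poly_gt0//; case: Gi.
have szG : size G = k.+1 by rewrite prednK ?size_poly_gt0.
have Gk : G`_k = 1 by have /monicP := Gm; rewrite lead_coefE.
have [f0|f_neq0] := eqVneq f 0.
  have d1 : d = 1%N by apply: (fP d 0) => //; rewrite f0 expr0n gtn_eqF.
  by rewrite /p d1 f0 expr1; exact: irredp_XsubC.
have G0 : G`_0 != 0.
  apply: contraTneq Gp => G0; apply/negP => /dvdpP[h ph].
  have : p`_0 = 0 by rewrite ph coef0M G0 mulr0.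
  by rewrite coefB coefXn coefC eqxx (ltn_eqF d_gt0) sub0r => /eqP; rewrite oppr_eq0 (negPf f_neq0).
pose g i := G \Po (z ^+ i *: 'X).
have zi0 i : z ^+ i != 0 by rewrite expf_neq0.
have gp i : g i %| p.
  have -> : p = p \Po (z ^+ i *: 'X).
    apply/polyP => j; rewrite coef_comp_scaleX coefB coefXn coefC.
    have [->|jd] := eqVneq j d.
      by rewrite gtn_eqF// exprAC (prim_expr_order zP) expr1n mulr1.
    by case: eqVneq => [->|]; rewrite ?expr0 ?subr0 ?mulr1 ?mul0r.
  exact: dvdp_comp_poly.
have gi i : irreducible_poly (g i).
  split; first by rewrite size_comp_scaleX//; case: Gi.
  move=> q q1 qg.
  have zV : z ^- i != 0 by rewrite invr_eq0.
  have gK : g i \Po (z ^- i *: 'X) = G.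
    by rewrite comp_scaleXK mulfV// scale1r comp_polyXr.
  have : q \Po (z ^- i *: 'X) %= G.
    apply: Gi.2; first by rewrite size_comp_scaleX.
    by rewrite -[X in _ %| X]gK dvdp_comp_poly.
  rewrite /eqp => /andP[h1 h2]; rewrite qg /=.
  have := dvdp_comp_poly (z ^+ i *: 'X) h2.
  by rewrite comp_scaleXK mulVf// scale1r comp_polyXr.
have exP : exists t, (0 < t)%N && (g t == z ^+ (t * k) *: G).
  exists d; rewrite d_gt0 /g (prim_expr_order zP) exprM (prim_expr_order zP).
  by rewrite expr1n !scale1r comp_polyXr eqxx.
case: (ex_minnP exP) => t /andP[t_gt0 /eqP gt] t_min.
(* Substituting [z ^- i X] moves a proportionality between [g i] and [g j] back to [G]; the factor
   is read off from the leading coefficients. *)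
have gE i j : (i < j)%N -> g i %= g j -> g (j - i)%N = z ^+ ((j - i) * k) *: G.
  move=> ij /eqpfP Eij.
  have lcg i' : lead_coef (g i') = z ^+ (i' * k).
    by rewrite lead_coefE size_comp_scaleX// coef_comp_scaleX Gk mul1r -exprM.
  move: Eij; rewrite !lcg => Eij.
  apply/polyP => a; have := congr1 (fun h : {poly K} => h`_a) Eij.
  rewrite !(coefZ, coef_comp_scaleX) => Ea.
  have [dl jE] : exists dl, j = (dl + i)%N by exists (j - i)%N; rewrite subnK// ltnW.
  move: Ea; rewrite jE addnK -!exprM !mulnDl !exprD => Ea.
  apply: (mulIf (zi0 (i * a)%N)); rewrite -[RHS]mulrA Ea.
  by field; rewrite !zi0.
have tk_le : (t * k <= d)%N.
  have Dv : \prod_(i <- iota 0 t) g i %| p.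
    apply: dvdp_prod_coprime => [|i j|i _]; [exact: iota_uniq| |exact: gp].
    rewrite !mem_iota !add0n !leq0n /= => it jt ij.
    apply: coprimep_irreducible => //; apply/negP => Eij.
    wlog lt_ij : i j it jt ij Eij / (i < j)%N.
      move=> H; have [|ji|e] := ltngtP i j; first exact: H.
        by apply: (H j i) => //; rewrite 1?eq_sym// eqp_sym.
      by rewrite e eqxx in ij.
    have := t_min (j - i)%N; rewrite subn_gt0 lt_ij (gE _ _ lt_ij Eij) eqxx.
    by move=> /(_ isT); rewrite leqNgt (leq_ltn_trans (leq_subr _ _) jt).
  have p0 : p != 0 by rewrite -size_poly_eq0 szp.
  have := dvdp_leq p0 Dv.
  rewrite szp size_prod_seq; last first.
    by move=> i _; rewrite -size_poly_eq0 size_comp_scaleX// szG.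
  under eq_bigr => i _ do rewrite size_comp_scaleX// szG.
  rewrite big_const_seq iter_addn_0 count_predT size_iota; lia.
have coefG i : G`_i != 0 -> z ^+ (t * i) = z ^+ (t * k).
  move=> Gi0; apply: (mulfI Gi0); rewrite exprM -coef_comp_scaleX -/(g t) gt coefZ.
  by rewrite mulrC.
have tk : (t * k)%N = d.
  apply/eqP; rewrite eqn_leq tk_le dvdn_leq ?muln_gt0 ?t_gt0//.
  by rewrite (prim_order_dvd zP) -(coefG _ G0) muln0 expr0.
have GE : G = 'X^k - (- G`_0)%:P.
  apply/polyP => i; rewrite coefB coefXn coefC.
  have [->|ik] := eqVneq i k; first by rewrite gtn_eqF// subr0.
  have [->|i0] := eqVneq i 0%N; first by rewrite opprK add0r.
  have [ki|ki] := ltnP k i; first by rewrite nth_default ?szG// subr0.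
  rewrite subr0; apply/eqP/negPn/negP => /coefG; rewrite tk (prim_expr_order zP) => /eqP.
  rewrite -(prim_order_dvd zP).
  move=> /dvdn_leq; rewrite muln_gt0 t_gt0 lt0n i0 -tk leq_pmul2l// => /(_ isT).
  by rewrite leqNgt ltn_neqAle ik ki.
have fE : f = (- G`_0) ^+ t.
  have : G %| (f - (- G`_0) ^+ t)%:P.
    have -> : (f - (- G`_0) ^+ t)%:P = ('X^k) ^+ t - ((- G`_0)%:P) ^+ t - p :> {poly K}.
      by rewrite /p -tk -exprM mulnC polyCB rmorphXn /=; ring.
    apply: dvdp_sub => //; rewrite subrXX; apply: dvdp_mulr; by rewrite -GE.
  move=> Gd; apply/eqP; rewrite -subr_eq0; apply: contraTT Gd => ne.
  by rewrite gtNdvdp ?polyC_eq0// size_polyC ne szG ltnS.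
have t1 : t = 1%N by apply: fP fE; rewrite -tk dvdn_mulr.
suff Gpp : G %= p.
  split; first by rewrite szp ltnS.
  move=> q q1; rewrite -(eqp_dvdr _ Gpp) => /(Gi.2 _ q1) /eqp_trans; exact.
by rewrite -dvdp_size_eqp// szG szp -tk t1 mul1n.
Qed.

(** * Norms of functions on the curve y^d = f(x) *)

Lemma size_prod_bound (F : fieldType) (I : finType) (G : I -> {poly F}) l :
  (forall i, (size (G i) <= l.+1)%N) -> (size (\prod_i G i)%R <= (#|I| * l).+1)%N.
Proof.
move=> H; have [/existsP[i /eqP Gi]|/existsPn N] := boolP [exists i, G i == 0%R].
  by rewrite (bigD1 i)//= Gi mul0r size_poly0.
rewrite size_prod => [|i _]; last exact: N.
have : (\sum_i size (G i) <= #|I| * l.+1)%N.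
  by rewrite -sum_nat_const; apply: leq_sum.
rewrite mulnS => H2; rewrite leq_subLR addnS ltnS; exact: H2.
Qed.

Lemma size_det_bound (F : fieldType) n (A : 'M[{poly F}]_n) l :
  (forall i j, (size (A i j) <= l.+1)%N) -> (size (\det A) <= (n * l).+1)%N.
Proof.
move=> H; apply: (leq_trans (size_sum _ _ _)); apply/bigmax_leqP => s _.
rewrite -signr_odd mulr_sign; case: ifP => _; rewrite ?size_polyN;
by have := @size_prod_bound F 'I_n (fun i => A i (s i)) l; rewrite card_ord; apply.
Qed.

Lemma fraction_num_den (R : idomainType) (x : {fraction R}) :
  exists u v : R, v != 0 /\ x * tofrac v = tofrac u.
Proof.
exists (repr x).1, (repr x).2; split; first exact: denom_ratioP.
have d0 := denom_ratioP (repr x).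
rewrite -{1}[x]reprK; unlock tofrac; rewrite -[LHS]FracField.pi_mul.
apply/eqmodP; rewrite /= /FracField.equivf /FracField.mulf /=.
by rewrite !numden_Ratio ?(oner_neq0, mulr1)// mulrC.
Qed.

Section NormBound.

Variables (F : fieldType) (d : nat) (z : F) (f Y : {poly F}) (N : nat).
Hypothesis zP : d.-primitive_root z.
Hypothesis f_nopower : forall t (u v : {poly F}),
  (t %| d)%N -> v != 0 -> f * v ^+ t = u ^+ t -> t = 1%N.
Hypothesis YP : 'X^N %| Y ^+ d - f.

(** With denominators cleared, [f_nopower] says that [f] is no [t]-th power of a rational function
    for any divisor [t > 1] of [d]. Hence [y^d - f] is irreducible over the field of rational
    functions and shares no factor with a nonzero [nu] of smaller degree in [y]. *)
Lemma gcdp_XnsubC_fraction (nu : {poly {poly F}}) :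
  nu != 0 -> (size nu <= d)%N -> size (gcdp nu ('X^d - f%:P)) = 1%N.
Proof.
move=> nu0 nud; have d_gt0 := prim_order_gt0 zP.
have [T TE] : exists T : {rmorphism {poly F} -> {fraction {poly F}}},
    forall x, T x = tofrac x by exists (@tofrac {poly F}).
have Tinj : injective T by move=> a b /eqP; rewrite !TE tofrac_eq => /eqP.
have T0 x : (T x == 0) = (x == 0) by rewrite TE tofrac_eq0.
have zKP : d.-primitive_root (T z%:P).
  by have := fmorph_primitive_root (T \o polyC : {rmorphism F -> {fraction {poly F}}}) d z; rewrite /= => ->.

have irr : irreducible_poly ('X^d - (T f)%:P).
  apply: XnsubC_irreducible zKP _ => t x td fx.
  have [u [v [v0 xv]]] := fraction_num_den x; rewrite -!TE in xv.
  apply: (@f_nopower _ u _ td v0); apply: Tinj.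
  rewrite rmorphM !rmorphXn /= -xv.
  by rewrite exprMn -fx.
set g := gcdp _ _.
have nuK0 : map_poly T nu != 0 by rewrite map_poly_eq0_id0 // T0 lead_coef_eq0.
have EK : map_poly T ('X^d - f%:P) = 'X^d - (T f)%:P.
  by rewrite rmorphB /= map_polyXn map_polyC.
(* Division over [{poly F}] holds up to a nonzero factor [c], which becomes invertible in the
   fraction field. *)
have dvdK p : g %| p -> map_poly T g %| map_poly T p.
  move=> /Pdiv.Idomain.dvdpP[[c q]] /= c0 E.
  have : T c *: map_poly T p = map_poly T q * map_poly T g.
    by rewrite -rmorphM -E -map_polyZ.
  by move=> E'; rewrite -(@dvdpZr _ (T c)) ?T0// E' dvdp_mull.
have gnu := dvdK _ (dvdp_gcdl _ _); have gf := dvdK _ (dvdp_gcdr _ _).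
have szg : size (map_poly T g) = size g by apply: size_map_poly_id0; rewrite T0 lead_coef_eq0 gcdp_eq0 (negPf nu0).
apply/eqP/negPn/negP => gN1.
have : map_poly T g %= 'X^d - (T f)%:P by apply: irr.2; rewrite ?szg // -EK.
move=> /eqp_size; rewrite szg size_XnsubC// => szgd.
have := dvdp_leq nuK0 gnu; rewrite szg szgd => lt.
have szn : size (map_poly T nu) = size nu by apply: size_map_poly_id0; rewrite T0 lead_coef_eq0.
have := leq_trans lt (leq_trans (eq_leq szn) nud).
by rewrite ltnn.
Qed.

(* On the curve [y^d = f], a function with few poles cannot vanish to high order
   at the point [(0, Y(0))]: its norm, here the resultant of [nu] and [y^d - f],
   is a polynomial of low degree divisible by ['X^N], hence zero. *)
Lemma norm_bound l (nu : {poly {poly F}}) :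
  (size f <= l.+1)%N -> (size nu <= d)%N -> (forall i, (size (nu`_i)%R <= l.+1)%N) ->
  (2 * d * l.+1 <= N)%N -> 'X^N %| nu.[Y] -> nu = 0.
Proof.
move=> szf nud szn wN dvdY; have d_gt0 := prim_order_gt0 zP.
have small (h : {poly F}) : 'X^N %| h -> (size h <= N)%N -> h = 0.
  move=> dv szh; apply: contraTeq dv => h0.
  by rewrite gtNdvdp// size_polyXn ltnS.
have [nuC|nu_nC] := leqP (size nu) 1%N.
  have [c nuE] : exists c, nu = c%:P by exists nu`_0; apply: size1_polyC.
  rewrite nuE; suff -> : c = 0 by [].
  apply: small; first by move: dvdY; rewrite nuE hornerC.
  have := szn 0%N; rewrite nuE coefC eqxx => /leq_trans; apply.
  by apply: leq_trans wN; rewrite leq_pmull// muln_gt0.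
have [//|nu0] := eqVneq nu 0.
pose P : {poly {poly F}} := 'X^d - f%:P.
have szP : size P = d.+1 by rewrite size_XnsubC.
have P_nC : (1 < size P)%N by rewrite szP ltnS.
have [uv _ E] := resultant_in_ideal nu_nC P_nC.
suff : resultant nu P == 0 by rewrite resultant_eq0 gcdp_XnsubC_fraction.
apply/eqP/small.
  (* The resultant is a combination of [nu] and [y^d - f]; at [y = Y] both are divisible by
     ['X^N]. *)
  have := congr1 (fun p => p.[Y]) E; rewrite hornerC !hornerE => ->.
  by apply: dvdp_add; apply: dvdp_mull; rewrite // !hornerE.
have szS i j : (size (Sylvester_mx nu P i j) <= l.+1)%N.
  rewrite Sylvester_mxE; case: (split i) => k.
    by case: (k <= j)%N; rewrite ?mulr1n ?mulr0n ?size_poly0.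
  case: (k <= j)%N; rewrite ?mulr1n ?mulr0n ?size_poly0// coefB coefXn coefC.
  case: eqVneq => [->|_]; first by rewrite gtn_eqF// subr0 size_poly1.
  by case: ifP => _; rewrite sub0r size_polyN ?size_poly0.
apply: leq_trans (size_det_bound szS) _; apply: leq_trans wN.
rewrite szP /=.
(* The Sylvester matrix has at most [2 d - 1] rows, with entries of degree at most [l]; this is the
   origin of [2 * d * l.+1]. *)
have h : (d + (size nu).-1 <= 2 * d - 1)%N by rewrite (leq_trans _ (_ : d + d.-1 <= _))%N ?leq_add2l; lia.
apply: (@leq_trans ((2 * d - 1) * l.+1).+1); last by nia.
by rewrite ltnS leq_mul.
Qed.
End NormBound.

(** * Residue fields of the polynomial ring over a finite field *)

(** The field [F[x]/(p)] is known only through its order and a surjective morphism [ev] with kernel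
    [(p)]; congruences modulo [p] become equations between values of [ev]. *)
Lemma residue_field_exists (F : finFieldType) (p : {poly F}) :
  p \is monic -> irreducible_poly p ->
  exists (E : finFieldType) (ev : {rmorphism {poly F} -> E}),
    [/\ #|E| = (#|F| ^ (size p).-1)%N,
        forall g, (ev g == 0) = (p %| g) & forall y, exists g, ev g = y].
Proof.
move=> pm pirr; have pI : monic_irreducible_poly p by split.
exists {poly %/ p with pI}.
pose ev := (in_qpoly p : {poly F} -> {poly %/ p with pI}).
exists ev; split.
- exact: card_qfpoly.
- move=> g; rewrite -val_eqE /= (mk_monicE pI).
  by rewrite dvdpE.
- move=> y; exists (val y); apply: val_inj.
  exact/in_qpoly_small/size_mk_monic.
Qed.

Lemma pchar_nat_card (F : finFieldType) (A : comNzRingType) (h : {rmorphism F -> A}) n :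
  [pchar A].-nat (#|F| ^ n)%N.
Proof.
have [p p_pr pF] := finPcharP F.
have pA := rmorph_pchar h pF.
rewrite (eq_pnat _ (pcharf_eq pA)) pnatX.
by rewrite (card_pprimeChar pF) pnatX pnat_id.
Qed.

Lemma expr_card_sum (F : finFieldType) (A : comNzRingType) (h : {rmorphism F -> A}) n
    (I : Type) (r : seq I) (P : pred I) (G : I -> A) :
  (\sum_(i <- r | P i) G i) ^+ (#|F| ^ n) = \sum_(i <- r | P i) G i ^+ (#|F| ^ n).
Proof.
apply: (big_morph (fun x : A => x ^+ (#|F| ^ n))) => [x y|].
  by rewrite exprDn_pchar// pchar_nat_card.
by rewrite expr0n expn_eq0 gtn_eqF// (ltn_trans _ (finNzRing_gt1 F)).
Qed.

Lemma expf_card_exp (F : finFieldType) n (x : F) : x ^+ (#|F| ^ n) = x.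
Proof. by elim: n => [|n IHn]; rewrite ?expr1// expnSr exprM IHn expf_card. Qed.

Lemma poly_expr_card (F : finFieldType) n (p : {poly F}) :
  p ^+ (#|F| ^ n) = p \Po 'X^(#|F| ^ n).
Proof.
rewrite -{1}[p]coefK poly_def comp_polyE (expr_card_sum polyC).
by apply: eq_bigr => i _; rewrite exprZn expf_card_exp exprAC.
Qed.

Section IrreducibleFrobenius.

Variables (F : finFieldType) (p : {poly F}) (e : nat).
Hypotheses (pm : p \is monic) (pirr : irreducible_poly p) (szp : size p = e.+1).
Let q := #|F|.

Let q_gt1 : (1 < q)%N. Proof. exact: finNzRing_gt1. Qed.

Lemma rmorph_poly_horner (E : nzRingType) (ev : {rmorphism {poly F} -> E}) (g : {poly F}) n :
  ev (g \Po 'X^n) = (map_poly (ev \o polyC) g).[ev 'X ^+ n].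
Proof.
rewrite comp_polyE rmorph_sum horner_coef size_map_poly.
by apply: eq_bigr => i _; rewrite coef_map -mul_polyC rmorphM !rmorphXn.
Qed.

(** Frobenius fixes the coefficients of [p], so it permutes its roots. The [e] conjugates are
    distinct: a coincidence for [i < j < e] would propagate to every element of [E], giving a
    polynomial of degree [q ^ j] with [q ^ e] roots. *)
Lemma residue_frobenius_roots (E : finFieldType) (ev : {rmorphism {poly F} -> E}) :
  #|E| = (q ^ e)%N -> (forall g, (ev g == 0) = (p %| g)) ->
  (forall y, exists g, ev g = y) ->
  map_poly (ev \o polyC) p = \prod_(i < e) ('X - (ev 'X ^+ (q ^ i))%:P).
Proof.
move=> cE evP ev_surj; set pE := map_poly _ p.
have evX g i : (map_poly (ev \o polyC) g).[ev 'X ^+ (q ^ i)] = ev g ^+ (q ^ i).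
  by rewrite -rmorph_poly_horner -poly_expr_card rmorphXn.
have pEm : pE \is monic by rewrite map_monic.
pose rs := [seq ev 'X ^+ (q ^ i) | i <- iota 0 e].
have -> : \prod_(i < e) ('X - (ev 'X ^+ (q ^ i))%:P) = \prod_(x <- rs) ('X - x%:P).
  by rewrite big_map -[e in iota 0 e]subn0 -/(index_iota 0 e) big_mkord.
rewrite {1}(@all_roots_prod_XsubC _ pE rs); first by rewrite (monicP pEm) scale1r.
- by rewrite size_map size_iota size_map_poly szp.
- apply/allP => _ /mapP[i _ ->]; rewrite /root evX.
  have /eqP-> : ev p == 0 by rewrite evP.
  by rewrite expr0n expn_eq0 (gtn_eqF (ltnW q_gt1)).
rewrite uniq_rootsE map_inj_in_uniq ?iota_uniq// => i j.
rewrite !mem_iota !add0n !leq0n /= => ie je Eij; apply/eqP.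
wlog ij : i j ie je Eij / (i <= j)%N.
  by move=> H; have [|/ltnW ji] := leqP i j; [exact: H|rewrite eq_sym; apply: H].
rewrite eqn_leq ij leqNgt; apply/negP => lt_ij.
have all_y (y : E) : y ^+ (q ^ i) = y ^+ (q ^ j).
  by have [g <-] := ev_surj y; rewrite -(evX g i) -(evX g j) Eij.
have lt_q : (q ^ i < q ^ j)%N by rewrite ltn_exp2l.
have szD : size ('X^(q ^ j) - 'X^(q ^ i) : {poly E}) = (q ^ j).+1.
  by rewrite size_polyDl ?size_polyN ?size_polyXn.
have D0 : 'X^(q ^ j) - 'X^(q ^ i) != 0 :> {poly E} by rewrite -size_poly_eq0 szD.
have D_root : all (root ('X^(q ^ j) - 'X^(q ^ i))) (enum E).
  by apply/allP => y _; rewrite /root !hornerE all_y subrr.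
have := max_poly_roots D0 D_root (enum_uniq E).
by rewrite szD ltnS -cardE cE leq_exp2l// leqNgt je.
Qed.

Lemma dvdp_Xcard_sub_X N : (e %| N)%N -> p %| 'X^(q ^ N) - 'X.
Proof.
move=> /dvdnP[M ->]; have [E [ev [cE evP ev_surj]]] := residue_field_exists pm pirr.
rewrite -evP rmorphB /= subr_eq0; rewrite szp /= in cE.
have fix_e (y : E) : y ^+ (q ^ e) = y by rewrite -cE expf_card.
apply/eqP; elim: M => [|M IHM]; first by rewrite mul0n expn0.
have -> : 'X^(q ^ (M.+1 * e)) = ('X^(q ^ (M * e))) ^+ (q ^ e) :> {poly F}.
  by rewrite -exprM -expnD mulSn addnC.
rewrite rmorphXn; transitivity (ev 'X ^+ (q ^ e)); last exact: fix_e.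
by congr (_ ^+ _).
Qed.

(** The exponent [1 + q + ... + q^(N-1)] is the norm from the extension of degree [N]. For [N = e]
    the norm of [x - b] is the product of the conjugates [x^(q^i) - b], which is [(-1)^e p(b)]; a
    larger [N] repeats this product [N / e] times. *)
Lemma dvdp_norm_XsubC (b : F) N : (e %| N)%N ->
  p %| ('X - b%:P) ^+ (\sum_(i < N) q ^ i) - (((-1) ^+ e * p.[b]) ^+ (N %/ e))%:P.
Proof.
move=> /dvdnP[M ->]; have e_gt0 : (0 < e)%N by case: pirr; rewrite szp ltnS.
rewrite mulnK//.
have [E [ev [cE evP ev_surj]]] := residue_field_exists pm pirr.
rewrite -evP rmorphB /= subr_eq0; rewrite szp /= in cE.
pose c := (-1) ^+ e * p.[b].
have base : ev (('X - b%:P) ^+ (\sum_(i < e) q ^ i)) = ev c%:P.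
  have := congr1 (fun g : {poly E} => g.[ev b%:P]) (residue_frobenius_roots cE evP ev_surj).
  rewrite horner_prod -[ev b%:P]/((ev \o polyC) b) horner_map /= => Epb.
  have evc : ev c%:P = \prod_(i < e) - (ev b%:P - ev 'X ^+ (q ^ i)).
    rewrite prodrN card_ord /c polyCM rmorphM Epb polyC_exp polyCN rmorphXn rmorphN /= !rmorph1.
    by congr (_ * _); apply: eq_bigr => i _; rewrite !hornerE.
  rewrite evc expr_sum rmorph_prod; apply: eq_bigr => i _.
  rewrite poly_expr_card comp_polyB comp_polyX comp_polyC rmorphB /= opprB.
  by rewrite rmorphXn.
suff -> : ev (('X - b%:P) ^+ (\sum_(i < M * e) q ^ i)) = ev c%:P ^+ M.
  by rewrite -!rmorphXn.
elim: M => [|M IHM]; first by rewrite mul0n big_ord0 !expr0 rmorph1.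
rewrite mulSn big_split_ord /= exprD rmorphM base exprS; congr (_ * _).
have -> : (\sum_(i < M * e) q ^ (e + i) = (\sum_(i < M * e) q ^ i) * q ^ e)%N.
  by rewrite big_distrl; apply: eq_bigr => i _; rewrite expnD mulnC.
rewrite exprM rmorphXn IHM -!rmorphXn.
by rewrite -exprM mulnC exprM expf_card_exp.
Qed.

End IrreducibleFrobenius.

(** * Stepanov's method *)

(** Over a finite field the pigeonhole principle is enough: two assignments with the same image
    differ by a nontrivial solution. *)
Lemma linear_system_nontrivial (F : finFieldType) (U V : finType) (w : U -> V -> F) :
  (#|V| < #|U|)%N ->
  exists2 t : {ffun U -> F}, t != 0 & forall v, \sum_u t u * w u v = 0.
Proof.
move=> ltVU; pose L (t : {ffun U -> F}) := [ffun v => \sum_u t u * w u v].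
have /injectivePn[t1 [t2 t12 EL]] : ~~ injectiveb L.
  apply/negP => /injectiveP/leq_card; rewrite !card_ffun.
  by rewrite leq_exp2l ?finNzRing_gt1// leqNgt ltVU.
exists (t1 - t2) => [|v]; first by rewrite subr_eq0.
have /ffunP/(_ v) := EL; rewrite !ffunE => /eqP; rewrite -subr_eq0 -sumrB => /eqP E.
by rewrite -[RHS]E; apply: eq_bigr => u _; rewrite !ffunE mulrBl.
Qed.

Lemma poly_system_nontrivial (F : finFieldType) (U K : finType) (w : U -> K -> {poly F}) B :
  (forall u k, (size (w u k) <= B)%N) -> (#|K| * B < #|U|)%N ->
  exists2 t : {ffun U -> F}, t != 0 & forall k, \sum_u t u *: w u k = 0.
Proof.
move=> szw lt; have [|t t0 tE] := @linear_system_nontrivial F U (K * 'I_B)%type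
    (fun u ki => (w u ki.1)`_ki.2).
  by rewrite card_prod card_ord.
exists t => // k; apply/polyP => i; rewrite coef0 coef_sum.
have [iB|iB] := ltnP i B.
  rewrite -[RHS](tE (k, Ordinal iB)); apply: eq_bigr => u _.
  by rewrite coefZ.
by rewrite big1// => u _; rewrite coefZ nth_default ?mulr0// (leq_trans (szw _ _)).
Qed.

(** For [N = q^n] one has [f^N = f(X^N)], which is 1 modulo [X^N], and [N - (N - 1)/d] is an inverse
    of [d] modulo [N]: [d] times it is [1 + (d - 1) N]. So a power of [f] already serves as the
    root. *)
Lemma dth_root_mod_exists (F : finFieldType) (f : {poly F}) d n :
  (0 < d)%N -> (d %| #|F|.-1)%N -> f.[0] = 1 ->
  exists Y : {poly F}, 'X^(#|F| ^ n) %| Y ^+ d - f.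
Proof.
move=> d_gt0 dq f0; set N := (#|F| ^ n)%N.
have dN : (d %| N.-1)%N by rewrite /N predn_exp dvdn_mulr.
have N_gt0 : (0 < N)%N by rewrite expn_gt0 (ltnW (finNzRing_gt1 F)).
exists (f ^+ (N - N.-1 %/ d)).
have -> : (f ^+ (N - N.-1 %/ d)) ^+ d - f = f * (f ^+ N ^+ d.-1 - 1).
  rewrite mulrBr mulr1 -!exprM -exprS; congr (_ ^+ _ - _).
  move/divnK: dN; have := leq_div N.-1 d; nia.
apply: dvdp_mull; rewrite subrX1; apply: dvdp_mulr.
rewrite (poly_expr_card n f) -/N (_ : 1 = f.[0]%:P); last by rewrite f0.
have -> : f \Po 'X^N - f.[0]%:P = (f - f.[0]%:P) \Po 'X^N.
  by rewrite comp_polyB comp_polyC.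
have : 'X %| f - f.[0]%:P.
  by rewrite -['X]subr0 -polyC0 dvdp_XsubCl /root !hornerE subrr.
by move=> /dvdpP[h ->]; rewrite comp_polyM comp_polyX dvdp_mull.
Qed.

Lemma size_sum_scaleX (R : nzRingType) d (a : 'I_d -> R) :
  (size (\sum_(i < d) a i *: 'X^i)%R <= d)%N.
Proof.
apply: (leq_trans (size_sum _ _ _)); apply/bigmax_leqP => i _.
by rewrite (leq_trans (size_scale_leq _ _))// size_polyXn.
Qed.

Lemma coef_sum_scaleX (R : nzRingType) d (a : 'I_d -> R) (j : 'I_d) :
  (\sum_(i < d) a i *: 'X^i)`_j = a j.
Proof.
rewrite coef_sum (bigD1 j)//= coefZ coefXn eqxx mulr1 big1 ?addr0// => i ij.
by rewrite coefZ coefXn [_ == _](_ : _ = (j == i)) // eq_sym (negPf ij) mulr0.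
Qed.

Lemma size_coef_sum_scaleX (F : fieldType) d (a : 'I_d -> {poly F}) l i :
  (forall j, (size (a j) <= l)%N) -> (size ((\sum_(i < d) a i *: 'X^i)`_i)%R <= l)%N.
Proof.
move=> H; have [id|di] := ltnP i d; first by rewrite (coef_sum_scaleX a (Ordinal id)).
by rewrite nth_default ?size_poly0// (leq_trans (size_sum_scaleX _)).
Qed.

Lemma dvdp_Xn_coef (F : fieldType) n (p : {poly F}) :
  (forall i, (i < n)%N -> p`_i = 0) -> 'X^n %| p.
Proof.
move=> H; rewrite -[p](poly_take_drop n) dvdp_addl ?dvdp_mull//.
suff -> : take_poly n p = 0 by exact: dvdp0.
by apply/polyP => i; rewrite coef_take_poly coef0; case: ifP => // /H.
Qed.

Lemma big_quadruple (R : nmodType) (A B C D : finType) (G : A * B * C * D -> R) :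
  \sum_u G u = \sum_c \sum_d \sum_a \sum_b G (a, b, c, d).
Proof.
rewrite (eq_bigr (fun u => (fun x d => G (x, d)) u.1 u.2)); last by case.
rewrite -(pair_bigA _ (fun x d => G (x, d))) /=.
rewrite (eq_bigr (fun u => (fun x c => \sum_d G (x, c, d)) u.1 u.2)); last by case.
rewrite -(pair_bigA _ (fun x c => \sum_d G (x, c, d))) /= exchange_big.
apply: eq_bigr => c _; rewrite exchange_big; apply: eq_bigr => d _.
rewrite (eq_bigr (fun u => (fun a b => G (a, b, c, d)) u.1 u.2)); last by case.
by rewrite -(pair_bigA _ (fun a b => G (a, b, c, d))).
Qed.

(** The [w n] behave like digits in base [X^P]. By [wP] a nonzero digit has order less than [P] at
    0, so the first nonzero term has smaller order than all later ones and cannot be cancelled. *)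
Lemma digits_eq0 (F : fieldType) (w : nat -> {poly F}) B M P :
  (forall n, 'X^P %| w n -> w n = 0) ->
  'X^(M * P) %| \sum_(n < B) 'X^(n * P) * w n ->
  forall n, (n < B)%N -> (n < M)%N -> w n = 0.
Proof.
move=> wP; rewrite -(big_mkord predT (fun n => 'X^(n * P) * w n)) => dvd n.
elim/ltn_ind: n => n IHn nB nM; apply: wP.
move: dvd; rewrite (@big_cat_nat _ _ _ n)//= ?(ltnW nB)// big_nat big1 ?add0r; last first.
  by move=> i /andP[_ lt_in]; rewrite (IHn i lt_in (ltn_trans lt_in nB) (ltn_trans lt_in nM)) mulr0.
rewrite big_ltn// => dvd.
have : 'X^(n * P) * 'X^P %| 'X^(n * P) * w n + \sum_(n.+1 <= i < B) 'X^(i * P) * w i.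
  rewrite -exprD addnC -mulSn; apply: dvdp_trans dvd.
  by rewrite dvdp_exp2l// leq_mul2r nM orbT.
rewrite dvdp_addl ?dvdp_mul2l ?expf_neq0 ?polyX_eq0//.
rewrite big_nat; apply: (big_ind (fun p => _ %| p)) => [|x y|i /andP[lt_ni _]].
- exact: dvdp0.
- exact: dvdp_add.
by apply: dvdp_mulr; rewrite -exprD dvdp_exp2l// addnC -mulSn leq_mul2r lt_ni orbT.
Qed.

Section Stepanov.

Variables (F : finFieldType) (d : nat) (z : F) (f : {poly F}) (n P1 m l : nat).
Hypothesis zP : d.-primitive_root z.
Hypothesis f0 : f.[0] = 1.
Hypothesis f_nopower : forall t (u v : {poly F}),
  (t %| d)%N -> v != 0 -> f * v ^+ t = u ^+ t -> t = 1%N.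
Let P := (#|F| ^ n)%N.
Hypothesis P_E : P = (d * P1).+1.
Hypothesis P1_gt0 : (0 < P1)%N.

Let U : finType := ('I_m * 'I_d * 'I_d * 'I_l)%type.

(* The coefficient of [y^k] in [sum nu_ab (x^a y^b)^P] on the curve [y^d = f],
   where [nu_ab = sum t_(a,b,e,i) x^i y^e] and [y^P = y f^P1]. *)
Definition stepanov_phi (t : {ffun U -> F}) (k : nat) : {poly F} :=
  \sum_(u : U) t u *: (let: (a, b, e, i) := u in
    if k == ((b + e) %% d)%N then 'X^(i + a * P) * f ^+ (b * P1 + (b + e) %/ d) else 0).

(* At a point where [x^(P^2) = x] and [y^(P^2) = c y], the [P]-th power of that
   function is [sum nu_ab^P x^a c^b y^b]; this is the contribution of one
   [t_(a,b,e,i)] to its coefficient of [y^k]. *)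
Definition stepanov_delta_term (c : F) (u : U) (k : nat) : {poly F} :=
  let: (a, b, e, i) := u in
  if k == ((b + e) %% d)%N
  then c ^+ b *: ('X^(i * P + a) * f ^+ (e * P1 + (b + e) %/ d)) else 0.

Let d_gt0 : (0 < d)%N. Proof. exact: prim_order_gt0 zP. Qed.

(** Since [y^P = y f^P1], the [P]-th power of [phi_k y^k] is [phi_k^P f^(k P1) y^k]. Comparing
    coefficients of [y^k], [phi_k^P f^(k P1)] equals the combination of delta terms in the residue
    field, which vanishes; [f] is invertible there because [f^(P1 (P+1)) = c] is nonzero. *)
Lemma stepanov_phi_dvd (c : F) (p : {poly F}) (t : {ffun U -> F}) (k : nat) :
  p \is monic -> irreducible_poly p -> c != 0 ->
  p %| 'X^(P ^ 2) - 'X -> p %| f ^+ (P1 * P.+1) - c%:P ->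
  \sum_u t u *: stepanov_delta_term c u k = 0 -> p %| stepanov_phi t k.
Proof.
move=> pm pirr c0; have [E [ev [_ evP _]]] := residue_field_exists pm pirr.
rewrite -!evP !rmorphB /= !subr_eq0 => /eqP evX /eqP evf delta0.
set g := ev f in evf *; have evc0 : ev c%:P != 0.
  by rewrite -[_ c%:P]/((ev \o polyC) c) fmorph_eq0.
have M_gt0 : (0 < P)%N by rewrite P_E.
have g0 : g != 0.
  apply: contraNneq evc0 => g0; rewrite -evf rmorphXn -/g g0 expr0n.
  by rewrite muln_eq0 (gtn_eqF P1_gt0).
have : ev (stepanov_phi t k) ^+ P * g ^+ (k * P1) = 0.
  rewrite -(rmorph0 ev) -delta0 /stepanov_phi !rmorph_sum /P (expr_card_sum (ev \o polyC)).
  rewrite mulr_suml; apply: eq_bigr => [[[[a b] e] i] _]; rewrite /stepanov_delta_term -/P.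
  case: eqP => [->|_]; last by rewrite !scaler0 rmorph0 expr0n gtn_eqF// mul0r.
  rewrite -!mul_polyC !rmorphM /= !exprMn.
  set s := t _; have -> : ev s%:P ^+ P = ev s%:P by rewrite -!rmorphXn expf_card_exp.
  rewrite -!mulrA; congr (_ * _).
  rewrite !rmorphXn /= -/g -evf rmorphXn -/g -!exprM -!exprD.
  have evX' : ev 'X ^+ (P ^ 2) = ev 'X by rewrite -rmorphXn.
  have EX : ev 'X ^+ ((i + a * P) * P) = ev 'X ^+ (i * P + a).
    by rewrite mulnDl -mulnA mulnn !exprD (mulnC a) (exprM _ (P ^ 2)%N) evX'.
  rewrite EX mulrCA; congr (_ * _); rewrite -exprD; congr (_ ^+ _).
  have := divn_eq (b + e) d; set h := ((b + e) %/ d)%N; set r := ((b + e) %% d)%N.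
  by rewrite P_E; nia.
move=> /eqP; rewrite mulf_eq0 [X in _ || X]expf_eq0 (negPf g0) andbF orbF.
by rewrite expf_eq0 M_gt0.
Qed.

(* Expanding [x^a Y^b] in powers of [x] turns [sum nu_ab (x^a Y^b)^P] into
   [sum_k x^(kP) u_k(Y)], where [u_k] combines the [nu_ab]; each nonzero [u_k]
   has order less than [P] at the origin, so that all of them must vanish. *)
Lemma stepanov_phi_neq0 D (t : {ffun U -> F}) :
  (size f <= D.+1)%N -> (d %| #|F|.-1)%N ->
  (2 * d * (l + D).+1 <= P)%N -> (2 * d * (m + D).+1 <= P ^ 3)%N ->
  (forall k : 'I_d, stepanov_phi t k = 0) -> t = 0.
Proof.
move=> szf dq le_P le_P3 phi0.
(* Precision [P ^ 4] covers [P ^ 3] digits of length [P] each. *)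
have [Y] := dth_root_mod_exists (n * 4) d_gt0 dq f0; rewrite expnM -/P => YP.
have Yw w : (w <= P ^ 4)%N -> 'X^w %| Y ^+ d - f.
  by move=> wP; apply: dvdp_trans YP; rewrite dvdp_exp2l.
have P_gt0 : (0 < P)%N by rewrite P_E.
pose S := \sum_(u : U) t u *: (let: (a, b, e, i) := u in
   'X^i * Y ^+ e * ('X^a * Y ^+ b) ^+ P).
(* [S] differs from [\sum_k phi_k Y^k], which is 0, only by replacing [Y^d] by [f]. *)
have dvdS : 'X^(P ^ 3 * P) %| S.
  have -> : S = S - \sum_(k < d) stepanov_phi t k * Y ^+ k.
    by rewrite [X in _ - X]big1 ?subr0// => k _; rewrite phi0 mul0r.
  have -> : \sum_(k < d) stepanov_phi t k * Y ^+ k =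
     \sum_(u : U) t u *: (let: (a, b, e, i) := u in
        'X^(i + a * P) * f ^+ (b * P1 + (b + e) %/ d) * Y ^+ ((b + e) %% d)).
    under eq_bigr => k _ do rewrite mulr_suml.
    rewrite exchange_big; apply: eq_bigr => [[[[a b] e] i] _] /=.
    pose k0 := Ordinal (ltn_pmod (b + e) d_gt0).
    rewrite (bigD1 k0)//= eqxx big1 ?addr0 -?scalerAl// => k kk0.
    by rewrite ifN ?scaler0 ?mul0r.
  rewrite -sumrB; apply: (big_ind (fun p => _ %| p)); [exact: dvdp0|by move=> *; apply: dvdp_add|].
  move=> [[[a b] e] i] _; rewrite -scalerBr; rewrite -mul_polyC; apply: dvdp_mull.
  have -> : 'X^i * Y ^+ e * ('X^a * Y ^+ b) ^+ P
      - 'X^(i + a * P) * f ^+ (b * P1 + (b + e) %/ d) * Y ^+ ((b + e) %% d) =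
      'X^(i + a * P) * Y ^+ ((b + e) %% d) *
       ((Y ^+ d) ^+ (b * P1 + (b + e) %/ d) - f ^+ (b * P1 + (b + e) %/ d)).
    rewrite mulrBr; congr (_ - _); last by rewrite -!mulrA [Y ^+ _ * _]mulrC.
    rewrite exprMn -!exprM exprD -!mulrA; congr (_ * _).
    rewrite mulrCA; congr (_ * _); rewrite -!exprD; congr (_ ^+ _).
    by have := divn_eq (b + e) d; rewrite P_E; nia.
  apply: dvdp_mull; rewrite subrXX; apply: dvdp_mulr; apply: Yw.
  by rewrite -expnSr.
pose B := \max_(ab : 'I_m * 'I_d) size (('X^(ab.1) * Y ^+ ab.2)%R : {poly F}).
pose s (a : 'I_m) (b : 'I_d) k := ('X^a * Y ^+ b)`_k.
pose v k (e : 'I_d) : {poly F} := \sum_(i < l) (\sum_(a < m) \sum_(b < d) t (a, b, e, i) * s a b k) *: 'X^i.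
pose u k : {poly {poly F}} := \sum_(e < d) v k e *: 'X^e.
have SE : S = \sum_(k < B) 'X^(k * P) * (u k).[Y].
  have XYP (a : 'I_m) (b : 'I_d) : ('X^a * Y ^+ b) ^+ P = \sum_(k < B) s a b k *: 'X^(k * P).
    rewrite poly_expr_card -/P; have szB : (size (('X^a * Y ^+ b)%R : {poly F}) <= B)%N.
      exact: (@leq_bigmax _ (fun ab : 'I_m * 'I_d => size (('X^(ab.1) * Y ^+ ab.2)%R : {poly F})) (a, b)).
    rewrite [X in X \Po _](_ : _ = \sum_(k < B) s a b k *: 'X^k).
      rewrite [LHS](raddf_sum (comp_poly 'X^P)); apply: eq_bigr => k _ /=.
      by rewrite comp_polyZ rmorphXn /= comp_polyX -exprM mulnC.
    apply/polyP => k; have [kB|kB] := ltnP k B.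
      by rewrite (coef_sum_scaleX (fun i : 'I_B => s a b i) (Ordinal kB)).
    by rewrite !nth_default// (leq_trans _ kB)// size_sum_scaleX.
  transitivity (\sum_(u : U) \sum_(k < B) (t u * s u.1.1.1 u.1.1.2 k) *:
      ('X^(k * P) * 'X^(u.2) * Y ^+ u.1.2)).
    apply: eq_bigr => [[[[a b] e] i] _] /=; rewrite XYP mulr_sumr scaler_sumr.
    apply: eq_bigr => k _; rewrite -scalerAr scalerA; congr (_ *: _).
    by rewrite [RHS]mulrAC mulrC -mulrA [Y ^+ _ * _]mulrC mulrA.
  rewrite exchange_big; apply: eq_bigr => k _.
  rewrite big_quadruple horner_sum mulr_sumr; apply: eq_bigr => e _.
  rewrite hornerZ hornerXn mulr_suml mulr_sumr; apply: eq_bigr => i _.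
  rewrite -scalerAl -scalerAr scaler_suml; apply: eq_bigr => a _.
  by rewrite scaler_suml; apply: eq_bigr => b _; rewrite /= mulrA.
have szv k e : (size (v k e) <= (l + D).+1)%N.
  by rewrite (leq_trans (size_sum_scaleX _))// -addnS leq_addr.
have u0 k : 'X^P %| (u k).[Y] -> u k = 0.
  apply: (norm_bound zP f_nopower (Yw P _) (l := (l + D)%N)) => //.
  - by rewrite -{1}[P]expn1 leq_exp2l // P_E ltnS muln_gt0 d_gt0.
  - by rewrite (leq_trans szf)// ltnS leq_addl.
  - exact: size_sum_scaleX.
  - by move=> i; apply: size_coef_sum_scaleX.
have us0 k : (k < P ^ 3)%N -> u k = 0.
  move=> kP3; apply: (u0); have [kB|kB] := ltnP k B.
    have wP k' : 'X^P %| (u k').[Y] -> (u k').[Y] = 0 by move=> /u0 ->; rewrite horner0.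
    rewrite SE in dvdS.
    by rewrite (digits_eq0 wP dvdS kB kP3) dvdp0.
  rewrite /u big1 ?horner0 ?dvdp0// => e _; rewrite [v _ _]big1 ?scale0r// => i _.
  rewrite big1 ?scale0r// => a _; rewrite big1// => b _.
  rewrite /s nth_default ?mulr0// (leq_trans _ kB)//.
  exact: (@leq_bigmax _ (fun ab : 'I_m * 'I_d => size (('X^(ab.1) * Y ^+ ab.2)%R : {poly F})) (a, b)).
(* For fixed [e] and [i], the vanishing of [u k] for [k < P^3] says that [sum t x^a Y^b] has order
   at least [P^3], so the norm argument applies a second time, now to the indices [a] and [b]. *)
have G0 e i : \sum_(b < d) (\sum_(a < m) t (a, b, e, i) *: 'X^a) *: 'X^b = 0 :> {poly {poly F}}.
  apply: (norm_bound zP f_nopower (Yw (P ^ 3)%N _) (l := (m + D)%N)) => //.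
  - by rewrite leq_exp2l // P_E ltnS muln_gt0 d_gt0.
  - by rewrite (leq_trans szf)// ltnS leq_addl.
  - exact: size_sum_scaleX.
  - move=> j; apply: size_coef_sum_scaleX => b.
    by rewrite (leq_trans (size_sum_scaleX _))// -addnS leq_addr.
  apply: dvdp_Xn_coef => k kP.
  have := congr1 (fun p : {poly {poly F}} => p`_e) (us0 k kP).
  rewrite coef_sum_scaleX coef0 => /(congr1 (fun p : {poly F} => p`_i)).
  rewrite coef_sum_scaleX coef0 => Ev; rewrite -[RHS]Ev.
  rewrite horner_sum coef_sum [RHS]exchange_big; apply: eq_bigr => b _.
  rewrite hornerZ hornerXn mulr_suml coef_sum; apply: eq_bigr => a _.
  by rewrite -scalerAl coefZ.
apply/ffunP => [[[[a b] e] i]]; rewrite ffunE.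
have := congr1 (fun p : {poly {poly F}} => p`_b) (G0 e i); rewrite coef_sum_scaleX coef0.
by move=> /(congr1 (fun p : {poly F} => p`_a)); rewrite coef_sum_scaleX coef0.
Qed.
End Stepanov.

Lemma size_Xn_mul_exp_leq (F : fieldType) (f : {poly F}) D i s :
  (size f <= D.+1)%N -> (size ('X^i * f ^+ s)%R <= i + D * s + 1)%N.
Proof.
move=> szf; have [->|f0] := eqVneq (f ^+ s) 0; first by rewrite mulr0 size_poly0.
rewrite mulrC size_mulXn// addn1 -addnS leq_add2l.
rewrite (leq_trans (size_poly_exp_leq _ _))// ltnS leq_mul2r orbC.
by case: (size f) szf => [|k] //=; rewrite ltnS => ->.
Qed.

(* [m], [d] and [l] bound the ranges of the indices [a], [b], [e] and [i]; the
   inequalities say that there are more unknowns than equations, that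
   [norm_bound] applies twice, and that [phi] has degree [P ^ 2 / d + O(P)]. *)
Lemma stepanov_parameters d D P P1 l :
  (0 < d)%N -> P = (d * P1).+1 -> (12 * D + 19 <= P1)%N ->
  (4 * l <= P1)%N -> (P1 <= 4 * l + 3)%N ->
  let m := (P1 + 8 * D.+1)%N in
  [/\ (d * (l * P + m + D * P) < m * d * d * l)%N, (2 * d * (l + D).+1 <= P)%N,
      (2 * d * (m + D).+1 <= P ^ 3)%N &
      (d * (m * P + D * P) <= P ^ 2 + d * (8 * D.+1 + D) * P)%N].
Proof.
move=> d_gt0 P_E P1_ge l1 l2 m; have lD : (3 * D + 4 <= l)%N by lia.
have dle x : (x <= d * x)%N by rewrite leq_pmull.
split.
- have -> : (m * d * d * l = d * (m * d * l))%N by ring.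
  rewrite ltn_pmul2l//.
  have [e dE] : exists e, d = e.+1 by exists d.-1; rewrite prednK.
  have E : (m * d * l = l * P + l * (8 * D * d + 7 * d + e))%N.
    by rewrite P_E /m dE; ring.
  rewrite E -addnA ltn_add2l /m P_E dE.
  apply: (@leq_ltn_trans (4 * l + 3 + 8 * D.+1 + D * (e.+1 * (4 * l + 3)).+1)%N).
    have : (D * (e.+1 * P1).+1 <= D * (e.+1 * (4 * l + 3)).+1)%N by rewrite leq_mul2l ltnS leq_mul2l l2 !orbT.
    lia.
  have -> : (4 * l + 3 + 8 * D.+1 + D * (e.+1 * (4 * l + 3)).+1 =
     4 * l + 11 + 9 * D + 3 * (D * e.+1) + 4 * (l * (D * e.+1)))%N by ring.
  have -> : (l * (8 * D * e.+1 + 7 * e.+1 + e) =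
     8 * (l * (D * e.+1)) + 7 * (l * e.+1) + l * e)%N by ring.
  have : (D * e.+1 <= l * (D * e.+1))%N by rewrite leq_pmull//; lia.
  have : (l <= l * e.+1)%N by rewrite leq_pmulr.
  move: (l * e)%N (l * e.+1)%N (l * (D * e.+1))%N (D * e.+1)%N; lia.
- rewrite P_E (_ : 2 * d * (l + D).+1 = d * (2 * (l + D).+1))%N; last by ring.
  by rewrite leqW// leq_mul2l; lia.
- apply: (@leq_trans (P * 4)%N).
    rewrite (_ : 2 * d * (m + D).+1 = d * (2 * (m + D).+1))%N; last by ring.
    apply: (@leq_trans (d * (P1 * 4))%N); first by rewrite leq_mul2l /m; lia.
    by rewrite mulnA leq_mul2r P_E leqnSn orbT.
  have P2 : (2 <= P)%N by rewrite P_E ltnS (leq_trans _ (dle P1))//; lia.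
  by rewrite expnS leq_mul2l (@leq_mul 2 2 P P)// orbT.
- rewrite (_ : d * (m * P + D * P) = d * P1 * P + d * (8 * D.+1 + D) * P)%N; last by rewrite /m; ring.
  by rewrite leq_add2r -mulnn leq_mul2r P_E leqnSn orbT.
Qed.

(** A polynomial [phi] divisible by all minimal polynomials of a class bounds the number of points
    in that class by its degree, here [P^2 / d + O(P)]. What matters is that [C] depends on neither
    [n] nor [c]. *)
Lemma stepanov_bound (F : finFieldType) (d D : nat) (z : F) (f : {poly F}) :
  d.-primitive_root z -> (d %| #|F|.-1)%N -> f.[0] = 1 ->
  (forall t (u v : {poly F}),
    (t %| d)%N -> v != 0 -> f * v ^+ t = u ^+ t -> t = 1%N) ->
  (size f <= D.+1)%N ->
  exists C n0 : nat, forall n, (n0 <= n)%N -> forall c, c != 0 ->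
    exists phi : {poly F},
    [/\ phi != 0, (d * size phi <= (#|F| ^ n) ^ 2 + C * #|F| ^ n)%N &
     forall p, p \is monic -> irreducible_poly p ->
       p %| 'X^((#|F| ^ n) ^ 2) - 'X ->
       p %| f ^+ (((#|F| ^ n) ^ 2).-1 %/ d) - c%:P -> p %| phi].
Proof.
move=> zP dq f0 fnp szf; have d_gt0 := prim_order_gt0 zP.
exists (d * (8 * D.+1 + D))%N, (d * (12 * D + 20))%N => n n_ge c c0.
set P := (#|F| ^ n)%N; pose P1 := (P.-1 %/ d)%N.
have P_gt0 : (0 < P)%N by rewrite expn_gt0 (ltnW (finNzRing_gt1 F)).
have P_E : P = (d * P1).+1.
  by rewrite mulnC divnK ?prednK// /P predn_exp dvdn_mulr.
have P1_ge : (12 * D + 19 <= P1)%N.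
  have : (n < P)%N by rewrite ltn_expl// finNzRing_gt1.
  rewrite P_E ltnS => nP; rewrite -(leq_pmul2l d_gt0) (leq_trans _ (leq_trans n_ge nP))//.
  by rewrite leq_mul2l; lia.
(* The surplus of [m] over [P1] makes the unknowns outnumber the equations at a cost of [O(P)] in
   the degree; [l] near [P1 / 4] keeps degrees low enough for [norm_bound] at order [P]. *)
pose m := (P1 + 8 * D.+1)%N; pose l := (P1 %/ 4)%N.
have [l1 l2] : (4 * l <= P1 /\ P1 <= 4 * l + 3)%N by rewrite /l; lia.
have [sys le_P le_P3 szphi] := stepanov_parameters d_gt0 P_E P1_ge l1 l2.
rewrite -/m in sys le_P3 szphi.
have lt_P1P : (P1 < P)%N by rewrite P_E ltnS leq_pmull.
have P1_gt0 : (0 < P1)%N by lia.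
pose U : finType := ('I_m * 'I_d * 'I_d * 'I_l)%type.
have hdiv (b e : 'I_d) : ((b + e) %/ d <= 1)%N.
  by rewrite -ltnS ltn_divLR// mul2n -addnn -addSn leq_add// ltnW.
have ePle (e h : nat) : (e < d)%N -> (h <= 1)%N -> (e * P1 + h <= P)%N.
  by move=> ed h1; rewrite P_E -addn1 leq_add// leq_mul2r (ltnW ed) orbT.
have szw (u : U) (k : 'I_d) : (size (stepanov_delta_term f n P1 c u k) <= l * P + m + D * P)%N.
  case: u => [[[a b] e] i]; rewrite /stepanov_delta_term; case: ifP => _; last by rewrite size_poly0.
  rewrite (leq_trans (size_scale_leq _ _))// (leq_trans (size_Xn_mul_exp_leq _ _ szf))//.
  have : (D * (e * P1 + (b + e) %/ d) <= D * P)%N by rewrite leq_mul2l ePle ?orbT.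
  have : (i * #|F| ^ n <= l.-1 * P)%N by rewrite leq_mul2r -ltnS prednK ?ltn_ord ?orbT//; lia.
  have := ltn_ord a; have := mulSn l.-1 P; rewrite prednK; last lia.
  rewrite -/P; lia.
have [|t t0 tE] := poly_system_nontrivial szw; first by rewrite !card_prod !card_ord.
have [k phik] : exists k : 'I_d, stepanov_phi f n P1 t k != 0.
  apply: contrapT => H; move/negP: t0; apply; apply/eqP.
  apply: (stepanov_phi_neq0 zP f0 fnp P_E P1_gt0 szf dq le_P le_P3) => k.
  by apply/eqP/negPn/negP => phik; apply: H; exists k.
exists (stepanov_phi f n P1 t k); split=> //.
- apply: leq_trans szphi; rewrite leq_mul2l; apply/orP; right.
  apply: (leq_trans (size_sum _ _ _)); apply/bigmax_leqP => [[[[a b] e] i] _].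
  rewrite (leq_trans (size_scale_leq _ _))//; case: ifP => _; last by rewrite size_poly0.
  rewrite (leq_trans (size_Xn_mul_exp_leq _ _ szf))//.
  have : (D * (b * P1 + (b + e) %/ d) <= D * P)%N by rewrite leq_mul2l ePle ?orbT.
  have : (a * #|F| ^ n <= m.-1 * P)%N by rewrite leq_mul2r -ltnS prednK ?ltn_ord ?orbT//; rewrite /m; lia.
  have := ltn_ord i; have := mulSn m.-1 P; rewrite prednK; last by rewrite /m; lia.
  rewrite -/P; lia.
- move=> p pm pirr pX pf; apply: (stepanov_phi_dvd zP P_E P1_gt0 pm pirr c0 pX) (tE k).
  move: pf; rewrite -/P (_ : (P ^ 2).-1 %/ d = P1 * P.+1)%N//.
  by rewrite (_ : (P ^ 2).-1 = P1 * P.+1 * d)%N ?mulnK// P_E; lia.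
Qed.

(** * The L-function of a completely multiplicative function of polynomials *)

Section MonicPolynomials.

Variable F : finFieldType.
Let q := #|F|.

Definition monics n : seq {poly F} := [seq 'X^n + rVpoly v | v : 'rV[F]_n].
Definition irreds n : seq {poly F} := [seq p <- monics n | irreducibleb p].

Lemma mem_monics n (p : {poly F}) : (p \in monics n) = (p \is monic) && (size p == n.+1).
Proof.
apply/imageP/andP => [[v _ ->]|[pm /eqP szp]].
  have lt : (size (rVpoly v) < size ('X^n : {poly F}))%N by rewrite size_polyXn ltnS size_poly.
  by rewrite monicE lead_coefDl// lead_coefXn size_polyDl// size_polyXn eqxx.
exists (poly_rV (p - 'X^n)) => //; rewrite poly_rV_K ?subrKC//.
apply/leq_sizeP => j; rewrite leq_eqVlt => /predU1P[<-|nj].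
  by move/monicP: pm; rewrite coefB coefXn eqxx lead_coefE szp => ->; rewrite subrr.
by rewrite coefB coefXn gtn_eqF// subr0 nth_default// szp.
Qed.

Lemma monics_uniq n : uniq (monics n).
Proof.
rewrite map_inj_uniq ?enum_uniq// => u v /addrI.
exact: (can_inj rVpolyK).
Qed.

Lemma size_monics n : size (monics n) = (q ^ n)%N.
Proof. by rewrite size_map -cardE card_mx mul1n. Qed.

Lemma mem_irreds n (p : {poly F}) :
  p \in irreds n -> [/\ p \is monic, irreducible_poly p & size p = n.+1].
Proof.
by rewrite mem_filter mem_monics => /and3P[/irreducibleP ? ? /eqP].
Qed.

Lemma irredsP n (p : {poly F}) :
  p \is monic -> irreducible_poly p -> size p = n.+1 -> p \in irreds n.
Proof. by move=> pm /irreducibleP pi sp; rewrite mem_filter mem_monics pi pm sp eqxx. Qed.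

Lemma irreds0 : irreds 0 = [::].
Proof.
case E : (irreds 0) => [//|p s]; have : p \in irreds 0 by rewrite E mem_head.
by move=> /mem_irreds[_ [+ _] sp]; rewrite sp.
Qed.

Lemma monics0 : monics 0 = [:: 1].
Proof.
apply/perm_small_eq => //; apply: uniq_perm; rewrite ?monics_uniq// => p.
rewrite mem_monics inE; apply/andP/eqP => [[pm sp]|->]; last by rewrite monic1 size_poly1.
have /size_poly1P[c c0 pE] := sp; move: pm; rewrite pE monicE lead_coefC => /eqP->.
by rewrite polyC1.
Qed.

Lemma dvdp_exp_irreds e e' (p r h : {poly F}) t :
  p \in irreds e -> r \in irreds e' -> p != r ->
  (p ^+ t %| r * h) = (p ^+ t %| h).
Proof.
move=> /mem_irreds[pm pi _] /mem_irreds[rm ri _] pr.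
rewrite Gauss_dvdpr// coprimep_expl// coprimep_irreducible//.
by apply: contra pr => Epr; apply/eqP; apply/eqP; rewrite -eqp_monic.
Qed.

(** The multiplicity of [p] is counted as the number of [t >= 1] with [p^t] dividing. The cut-off
    [N] loses nothing on the right, since [p^N] has degree at least [N], more than [h]. *)
Lemma irreducible_multiplicity e e' (p r h : {poly F}) N :
  p \in irreds e -> r \in irreds e' -> h != 0 -> (size h <= N)%N ->
  (\sum_(1 <= t < N.+1) (p ^+ t %| r * h)%R =
   (p == r) + \sum_(1 <= t < N.+1) (p ^+ t %| h)%R)%N.
Proof.
move=> pI rI h0 szh; have [Epr|pr] := eqVneq p r; last first.
  by rewrite add0n; apply: eq_bigr => t _; rewrite (dvdp_exp_irreds _ _ pI rI).
have [pm pi szp] := mem_irreds pI; have p0 := monic_neq0 pm.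
rewrite -Epr big_add1 /=; under eq_bigr => t _ do rewrite exprS dvdp_mul2l//.
have [N0|N_gt0] := posnP N; first by move: szh h0; rewrite N0 leqn0 size_poly_eq0 => /eqP->; rewrite eqxx.
rewrite big_ltn// expr0 dvd1p; congr (_ + _)%N.
rewrite [RHS]big_nat_recr//= [X in (_ + nat_of_bool X)%N](_ : _ = false) ?addn0; last first.
  apply: negbTE; rewrite gtNdvdp// (leq_ltn_trans szh)//.
  have e_gt0 : (0 < e)%N by case: pi; rewrite szp ltnS.
  have := size_exp p N; rewrite szp /= => E; rewrite -(ltn_predK (_ : 0 < size (p ^+ N)))%N.
    by rewrite E ltnS leq_pmull.
  by rewrite size_poly_gt0 expf_neq0.
by [].
Qed.

(** Unique factorization in the only form that is used, as a count of degrees; it is the identity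
    behind the logarithmic derivative of an Euler product. One irreducible factor is split off at a
    time. *)
Lemma degree_irreducible_multiplicities n N (g : {poly F}) :
  g \in monics n -> (n <= N)%N ->
  (\sum_(e < N.+1) \sum_(p <- irreds e) e * \sum_(1 <= t < N.+1) (p ^+ t %| g)%R)%N = n.
Proof.
elim/ltn_ind: n g => n IHn g gM nN.
have [n0|n_gt0] := posnP n.
  move: gM; rewrite n0 monics0 inE => /eqP->.
  apply: big1 => e _; rewrite big_seq big1// => p /mem_irreds[_ [p_gt1 _] szp].
  rewrite big_nat big1 ?muln0// => t /andP[t_gt0 _].
  case: (boolP (_ %| 1)) => //; rewrite -(prednK t_gt0) exprS.
  by move=> /(dvdp_trans (dvdp_mulIl _ _)); rewrite dvdp1 => /eqP sp; rewrite sp in p_gt1.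
have [gm /eqP szg] : g \is monic /\ size g == n.+1 by apply/andP; rewrite -mem_monics.
have [|r [rm ri rg]] := @irreducible_factor_exists _ g; first by rewrite szg ltnS.
have [h gE] := dvdpP _ _ rg.
have hm : h \is monic by move: gm; rewrite gE (monicMr _ rm).
have [r0 h0] := (monic_neq0 rm, monic_neq0 hm).
pose e := (size r).-1.
have szr : size r = e.+1 by rewrite prednK// size_poly_gt0.
have e_gt0 : (0 < e)%N by case: ri; rewrite szr ltnS.
have rI : r \in irreds e by apply: irredsP.
have nE : n = ((size h).-1 + e)%N.
  have := size_mul h0 r0; rewrite -gE szg szr addnS /= => nE.
  have : (0 < size h)%N by rewrite size_poly_gt0.
  by move: nE; clearbody e; case: (size h) => // k [->].
have hM : h \in monics (size h).-1 by rewrite mem_monics hm prednK ?size_poly_gt0 ?eqxx.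
have {IHn} IH : _ = (size h).-1 := IHn _ _ h hM _.
have lt_hn : ((size h).-1 < n)%N by rewrite [X in (_ < X)%N]nE -addn1 leq_add2l.
have szh : (size h <= N)%N.
  by rewrite -(prednK (_ : 0 < size h)%N) ?size_poly_gt0// (leq_trans lt_hn).
have step (e' : nat) :
    (\sum_(p <- irreds e') e' * \sum_(1 <= t < N.+1) (p ^+ t %| g)%R =
     \sum_(p <- irreds e') e' * (p == r) +
     \sum_(p <- irreds e') e' * \sum_(1 <= t < N.+1) (p ^+ t %| h)%R)%N.
  rewrite -big_split /= big_seq [RHS]big_seq; apply: eq_bigr => p pI.
  by rewrite gE mulrC (irreducible_multiplicity pI rI h0 szh) mulnDr.
rewrite (eq_bigr _ (fun (e' : 'I_N.+1) _ => step e')) big_split /= IH//; last exact: leq_trans (ltnW lt_hn) nN.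
rewrite [RHS]nE addnC; congr (_ + _)%N.
have eN : (e < N.+1)%N by rewrite ltnS (leq_trans _ nN)// nE leq_addl.
rewrite (bigD1 (Ordinal eN))//= [X in (_ + X)%N]big1 ?addn0.
  rewrite (bigD1_seq r)//= ?filter_uniq ?monics_uniq// eqxx muln1 big1 ?addn0// => p /negPf->.
  by rewrite muln0.
move=> e' e'e; rewrite big_seq big1// => p /mem_irreds[_ _ szp].
case: eqVneq => [Epr|]; rewrite ?muln0//; move: e'e.
by rewrite -val_eqE /= /e -Epr szp eqxx.
Qed.

(** The minimal polynomials of the elements of the extension of degree [N]; each stands for as many
    elements as its degree. *)
Definition irreds_dvd N : seq {poly F} := flatten [seq irreds e | e <- divisors N].

Lemma mem_irreds_dvd N (p : {poly F}) : (0 < N)%N -> p \in irreds_dvd N ->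
  [/\ p \is monic, irreducible_poly p, size p = (size p).-1.+1 & ((size p).-1 %| N)%N].
Proof.
move=> N_gt0 /flatten_mapP[e]; rewrite -dvdn_divisors// => eN /mem_irreds[pm pi szp].
by split; rewrite // szp.
Qed.

Lemma irreds_dvd_uniq N : uniq (irreds_dvd N).
Proof.
rewrite /irreds_dvd; elim: (divisors N) (divisors_uniq N) => //= e s IHs /andP[es us].
rewrite cat_uniq filter_uniq ?monics_uniq// IHs// andbT.
apply/hasPn => p /flatten_mapP[e' e's /mem_irreds[_ _ szp]].
apply/negP => /mem_irreds[_ _]; rewrite szp => -[ee].
by rewrite -ee e's in es.
Qed.

Section LFunction.

Variables (R : comNzRingType) (lam : {poly F} -> R).
Hypothesis lam1 : lam 1 = 1.
Hypothesis lamM : {morph lam : g h / g * h}.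

Definition monic_sum n := \sum_(g <- monics n) lam g.
Definition prime_power_sum e t := \sum_(p <- irreds e) e%:R * lam p ^+ t.
(* For the character [lam], this is the sum over the points of the extension of
   degree [i] of the character of their norms: a point of degree [e] dividing [i]
   contributes [lam p ^+ (i / e)], [p] being its minimal polynomial. *)
Definition von_mangoldt_sum i :=
  \sum_(e < i.+1) \sum_(1 <= t < i.+1 | (e * t == i)%N) prime_power_sum e t.

Lemma lamX g t : lam (g ^+ t) = lam g ^+ t.
Proof. by elim: t => [|t IHt]; rewrite ?lam1// !exprS lamM IHt. Qed.

Lemma monic_sum_multiples e t (p : {poly F}) n :
  p \in irreds e ->
  \sum_(g <- monics n | p ^+ t %| g) lam g =
  if (e * t <= n)%N then lam p ^+ t * monic_sum (n - e * t) else 0.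
Proof.
move=> /mem_irreds[pm _ szp].
have ptm : p ^+ t \is monic by rewrite monic_exp.
have szpt : size (p ^+ t) = (e * t).+1.
  by have := size_exp p t; rewrite szp /= => <-; rewrite prednK// size_poly_gt0 monic_neq0.
case: leqP => [le_n|lt_n]; last first.
  rewrite big_seq_cond big1// => g /andP[]; rewrite mem_monics => /andP[gm /eqP szg] /dvdp_leq.
  by rewrite monic_neq0// szpt szg ltnS leqNgt lt_n => /(_ isT).
rewrite mulr_sumr -big_filter.
rewrite (perm_big [seq p ^+ t * h | h <- monics (n - e * t)]) /=.
  by rewrite big_map; apply: eq_bigr => h _; rewrite lamM lamX.
apply: uniq_perm; first by rewrite filter_uniq// monics_uniq.
  by rewrite map_inj_uniq ?monics_uniq//; apply/mulfI/monic_neq0.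
have szM h : h != 0 -> size (p ^+ t * h) = (e * t + size h)%N.
  by move=> h0; rewrite (size_mul (monic_neq0 ptm) h0) szpt.
move=> g; rewrite mem_filter; apply/andP/mapP => [[/dvdpP[h gE]]|[h]].
  rewrite mem_monics => /andP[gm /eqP szg]; exists h; last by rewrite mulrC.
  have hm : h \is monic by move: gm; rewrite gE (monicMr _ ptm).
  rewrite mem_monics hm; apply/eqP; move: szg.
  by rewrite gE mulrC szM ?monic_neq0// -(subnK le_n) addnK [(_ + e * t)%N]addnC -addnS => /addnI.
rewrite mem_monics => /andP[hm /eqP szh] ->; split; first exact: dvdp_mulIl.
by rewrite mem_monics monicMl// hm szM ?monic_neq0// szh addnS subnKC ?eqxx.
Qed.

Lemma von_mangoldt_sum_widen i N : (0 < i)%N -> (i <= N)%N ->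
  von_mangoldt_sum i =
  \sum_(e < N.+1) \sum_(1 <= t < N.+1 | (e * t == i)%N) prime_power_sum e t.
Proof.
move=> i_gt0 iN; rewrite /von_mangoldt_sum.
rewrite (big_ord_widen N.+1 (fun e => \sum_(1 <= t < i.+1 | (e * t == i)%N) prime_power_sum e t)) ?ltnS//.
rewrite [RHS](bigID (fun e : 'I_N.+1 => (e < i.+1)%N))/= [X in _ + X]big1 ?addr0.
  apply: eq_bigr => e _; rewrite (big_nat_widen _ _ N.+1) ?ltnS//.
  rewrite big_nat_cond [RHS]big_nat_cond; apply: eq_bigl => t.
  case: (boolP (e * t == i)%N) => /=; rewrite ?andbF// => /eqP Ei.
  rewrite andbT; have -> : (t < i.+1)%N by rewrite ltnS -Ei leq_pmull//; move: i_gt0; rewrite -Ei muln_gt0 => /andP[].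
  by rewrite andbT.
move=> e; rewrite -leqNgt => ie; rewrite big_nat_cond big1// => t /andP[/andP[t_gt0 _] /eqP Ei].
by move: ie; rewrite -Ei ltnNge leq_pmulr.
Qed.

(** The coefficients of [X L' = L * (X L' / L)]: each [g] is weighted by its degree, the degree is
    written as a sum over the prime powers [p^t] dividing [g], and the terms are sorted by
    [i = e * t]. *)
Lemma monic_sum_recurrence n :
  n%:R * monic_sum n = \sum_(1 <= i < n.+1) von_mangoldt_sum i * monic_sum (n - i).
Proof.
transitivity (\sum_(e < n.+1) \sum_(1 <= t < n.+1)
    if (e * t <= n)%N then prime_power_sum e t * monic_sum (n - e * t) else 0).
  transitivity (\sum_(g <- monics n) \sum_(e < n.+1) \sum_(p <- irreds e)
     \sum_(1 <= t < n.+1) if p ^+ t %| g then e%:R * lam g else 0).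
    rewrite mulr_sumr big_seq [RHS]big_seq; apply: eq_bigr => g gM.
    rewrite -{1}(degree_irreducible_multiplicities gM (leqnn n)) natr_sum mulr_suml.
    apply: eq_bigr => e _; rewrite natr_sum mulr_suml; apply: eq_bigr => p _.
    rewrite natrM natr_sum mulr_sumr mulr_suml; apply: eq_bigr => t _.
    by case: (_ %| _); rewrite ?mulr1// mulr0 mul0r.
  rewrite exchange_big; apply: eq_bigr => e _; rewrite exchange_big /=.
  under eq_bigr => p _ do rewrite exchange_big.
  rewrite exchange_big; apply: eq_bigr => t _.
  transitivity (\sum_(p <- irreds e) e%:R * \sum_(g <- monics n | p ^+ t %| g) lam g).
    by apply: eq_bigr => p _; rewrite mulr_sumr [RHS]big_mkcond.
  rewrite big_seq; under eq_bigr => p pI do rewrite (monic_sum_multiples t n pI).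
  rewrite -big_seq; case: ifP => _; last by rewrite big1// => p _; rewrite mulr0.
  by rewrite /prime_power_sum mulr_suml; apply: eq_bigr => p _; rewrite mulrA.
symmetry; rewrite big_nat; under eq_bigr => i /andP[i_gt0 i_le].
  rewrite (von_mangoldt_sum_widen i_gt0 i_le) mulr_suml; under eq_bigr => e _.
    rewrite big_mkcond mulr_suml; over.
  over.
rewrite -big_nat exchange_big; apply: eq_bigr => e _; rewrite exchange_big /=.
rewrite big_nat [RHS]big_nat; apply: eq_bigr => t /andP[t_gt0 _].
rewrite (eq_bigr (fun i => if i == (e * t)%N then prime_power_sum e t * monic_sum (n - i) else 0)); last first.
  by move=> i _; rewrite eq_sym; case: eqP => // _; rewrite mul0r.
rewrite -big_mkcond big_nat1_eq ltnS.
case: (posnP e) => [->|e_gt0]; last by rewrite muln_gt0 e_gt0 t_gt0.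
by rewrite mul0n /= /prime_power_sum irreds0 big_nil mul0r.
Qed.
Lemma von_mangoldt_sumE N : (0 < N)%N ->
  von_mangoldt_sum N =
  \sum_(p <- irreds_dvd N) (size p).-1%:R * lam p ^+ (N %/ (size p).-1).
Proof.
move=> N_gt0; rewrite big_flatten /= big_map.
transitivity (\sum_(e <- divisors N) prime_power_sum e (N %/ e)); last first.
  apply: eq_bigr => e _; rewrite /prime_power_sum big_seq [RHS]big_seq.
  by apply: eq_bigr => p /mem_irreds[_ _ ->].
rewrite (perm_big [seq e <- index_iota 0 N.+1 | (e %| N)%N]); last first.
  apply: uniq_perm; [exact: divisors_uniq|by apply: filter_uniq; exact: iota_uniq|move=> e].
  rewrite mem_filter mem_index_iota -dvdn_divisors//.
  by case: (boolP (e %| N)%N) => //= eN; rewrite ltnS dvdn_leq.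
rewrite big_filter [RHS]big_mkcond /von_mangoldt_sum.
rewrite -(big_mkord xpredT (fun e => \sum_(1 <= t < N.+1 | (e * t == N)%N) prime_power_sum e t)).
apply: eq_bigr => e _.
have [->|e_gt0] := posnP e.
  by rewrite dvd0n gtn_eqF// big1// => t _; rewrite /prime_power_sum irreds0 big_nil.
case: ifP => [/dvdnP[t NE]|eN]; last first.
  by rewrite big1// => t /eqP Et; move: eN; rewrite -Et dvdn_mulr.
rewrite [in RHS]NE mulnK// (eq_bigl (pred1 t)) => [|t'] /=; last first.
  by rewrite NE mulnC eqn_pmul2r.
rewrite big_nat1_eq ltnS NE leq_pmulr// andbT.
by rewrite NE muln_gt0 in N_gt0; case/andP: N_gt0 => ->.
Qed.

End LFunction.

Lemma monic_sum_one (R : comNzRingType) n : monic_sum (fun=> 1 : R) n = (q ^ n)%:R.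
Proof. by rewrite /monic_sum big_const_seq count_predT size_monics iter_addr addr0. Qed.

(* The recurrence for [lam = 1], where [monic_sum n = q ^ n]. *)
Lemma sum_degree_irreds_dvd N : (0 < N)%N ->
  (\sum_(p <- irreds_dvd N) (size p).-1)%N = (q ^ N)%N.
Proof.
pose one : {poly F} -> int := fun=> 1.
have lam1 : one 1 = 1 by [].
have lamM : {morph one : g h / g * h} by move=> g h; rewrite mulr1.
suff H n : (0 < n)%N -> von_mangoldt_sum one n = (q ^ n)%:R.
  move=> N_gt0; apply/eqP; rewrite -(eqr_nat int) -H// von_mangoldt_sumE//.
  by rewrite natr_sum; apply/eqP; apply: eq_bigr => p _; rewrite expr1n mulr1.
elim/ltn_ind: n => n IHn n_gt0.
have := monic_sum_recurrence lam1 lamM n; rewrite monic_sum_one big_nat_recr//= subnn.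
rewrite monic_sum_one expn0 mulr1.
rewrite big_nat (eq_bigr (fun=> (q ^ n)%:R)); last first.
  move=> i /andP[i_gt0 i_n]; rewrite IHn// monic_sum_one -natrM -expnD subnKC//.
  exact: ltnW.
rewrite -big_nat big_const_nat iter_addr addr0 => E.
have -> : von_mangoldt_sum one n =
   n%:R * (q ^ n)%:R - (q ^ n)%:R *+ (n - 1) by rewrite E [X in X - _]addrC addrK.
by rewrite mulr_natl -mulrnBr ?leq_subr// subKn.
Qed.

End MonicPolynomials.

(** * Reciprocal roots and power sums *)

Lemma bounded_powers_le1 (x C : algC) n0 :
  0 <= x -> (forall n, (n0 <= n)%N -> x ^+ n <= C) -> x <= 1.
Proof.
move=> x0 H; have xR : x \is Num.real by rewrite ger0_real.
have [//|x_gt1] := real_leP xR (real1 _).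
have C0 : 0 <= C by apply: le_trans (H n0 (leqnn _)); rewrite exprn_ge0.
have x10 : 0 < x - 1 by rewrite subr_gt0.
(* Bernoulli's inequality: powers of [x > 1] are unbounded. *)
have bern n : 1 + n%:R * (x - 1) <= x ^+ n.
  elim: n => [|n IHn]; first by rewrite mul0r addr0 expr0.
  rewrite exprS; apply: le_trans (_ : x * (1 + n%:R * (x - 1)) <= _); last by rewrite ler_pM2l// (lt_trans ltr01).
  rewrite -subr_ge0; have -> : x * (1 + n%:R * (x - 1)) - (1 + n.+1%:R * (x - 1)) = n%:R * (x - 1) ^+ 2.
    by rewrite -[n.+1]addn1 natrD; ring.
  by rewrite mulr_ge0 ?exprn_ge0// ltW.
pose N := Num.bound (C / (x - 1)).
have ltC : C < (N + n0)%:R * (x - 1).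
  rewrite -ltr_pdivrMr// natrD ltr_wpDr//.
  by have := archi_boundP (divr_ge0 C0 (ltW x10)).
have := le_trans (bern (N + n0)%N) (H _ (leq_addl _ _)).
by move=> /le_lt_trans/(_ ltC); rewrite -subr_gt0 opprD addrCA subrr addr0 oppr_gt0 ltr10.
Qed.

(* Apply to the power sums the linear filter with characteristic polynomial
   [g = prod_(y != z) (X - y)]: only the contribution of [z] survives. *)
Lemma power_sums_bound (zs : seq algC) (C rho : algC) n0 :
  0 < rho -> (forall n, (n0 <= n)%N -> `|\sum_(z <- zs) z ^+ n| <= C * rho ^+ n) ->
  {in zs, forall z, `|z| <= rho}.
Proof.
move=> rho0 H z zI.
pose g := \prod_(y <- undup zs | y != z) ('X - y%:P).
have gz : g.[z] != 0.
  rewrite horner_prod prodf_seq_neq0; apply/allP => y _; apply/implyP => yz.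
  by rewrite hornerXsubC subr_eq0 eq_sym.
have gy y : y \in zs -> y != z -> g.[y] = 0.
  move=> yI yz; rewrite /g -big_filter (bigD1_seq y) ?filter_uniq ?undup_uniq//=.
    by rewrite hornerM hornerXsubC subrr mul0r.
  by rewrite mem_filter yz mem_undup.
have key n : \sum_(i < size g) g`_i * (\sum_(y <- zs) y ^+ (n + i)) =
    (count_mem z zs)%:R * (g.[z] * z ^+ n).
  under eq_bigr => i _ do rewrite mulr_sumr.
  rewrite exchange_big /= big_seq.
  rewrite (eq_bigr (fun y => if y == z then g.[z] * z ^+ n else 0)).
    by rewrite -big_seq -big_mkcond /= big_const_seq iter_addr addr0 mulr_natl.
  move=> y yI; have [->|yz] := eqVneq y z.
    rewrite horner_coef mulr_suml; apply: eq_bigr => i _; rewrite exprD; ring.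
  transitivity (g.[y] * y ^+ n); last by rewrite gy// mul0r.
  by rewrite horner_coef mulr_suml; apply: eq_bigr => i _; rewrite exprD; ring.
pose K : algC := (count_mem z zs)%:R * `|g.[z]|.
have K0 : 0 < K by rewrite mulr_gt0 ?normr_gt0// ltr0n -has_count has_pred1.
pose B := \sum_(i < size g) `|g`_i| * (C * rho ^+ i).
rewrite -[rho]mul1r -ler_pdivrMr//.
apply: (@bounded_powers_le1 _ (B / K) n0); first by rewrite divr_ge0 ?normr_ge0 ?ltW.
move=> n n_ge; rewrite ler_pdivlMr// expr_div_n mulrAC ler_pdivrMr ?exprn_gt0//.
have -> : `|z| ^+ n * K = `|(count_mem z zs)%:R * (g.[z] * z ^+ n)|.
  by rewrite !normrM normrX normr_nat /K; ring.
rewrite -key /B mulr_suml; apply: (le_trans (ler_norm_sum _ _ _)); apply: ler_sum => i _.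
rewrite normrM -mulrA ler_wpM2l// -mulrA -exprD addnC.
by apply: H; rewrite (leq_trans n_ge)// leq_addl.
Qed.

(** Newton's identities, the coefficients of [X L' = - L * \sum_i p_i X^i] with [p_i] the power
    sums. In the induction [L = (1 - w X) M], and the geometric series of the new root times [L] is
    [w X M]; this is [tele]. *)
Lemma newton_power_sums (R : comNzRingType) (ws : seq R) n :
  let L := \prod_(w <- ws) (1 - w *: 'X) in
  n%:R * L`_n = - \sum_(1 <= i < n.+1) (\sum_(w <- ws) w ^+ i) * L`_(n - i).
Proof.
move=> /=; elim: ws n => [|w s IHs] n.
  rewrite big_nil coef1 big1 => [|i _]; last by rewrite big_nil mul0r.
  by case: n => [|n]; rewrite ?mul0r ?mulr0 oppr0.
rewrite big_cons; set M := \prod_(_ <- s) _ in IHs *.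
case: n => [|n]; first by rewrite big_nil mul0r oppr0.
have LE i : ((1 - w *: 'X) * M)`_i.+1 = M`_i.+1 - w * M`_i.
  by rewrite mulrBl mul1r -scalerAl coefB coefZ coefXM.
have L0 : ((1 - w *: 'X) * M)`_0 = M`_0.
  by rewrite mulrBl mul1r -scalerAl coefB coefZ coefXM mulr0 subr0.
set L := (1 - w *: 'X) * M in LE L0 *.
pose p i := \sum_(w <- s) w ^+ i.
have tele m : \sum_(1 <= i < m.+2) w ^+ i * L`_(m.+1 - i) = w * M`_m.
  elim: m => [|m IHm]; first by rewrite big_nat1 subnn expr1 L0.
  rewrite big_nat_recl//= subn1 /= LE expr1.
  under eq_bigr => i _ do rewrite subSS exprS -mulrA.
  by rewrite -mulr_sumr IHm; ring.
have shift m : \sum_(1 <= i < m.+2) p i * L`_(m.+1 - i) =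
   - (m.+1%:R * M`_m.+1) + w * (m%:R * M`_m).
  rewrite (IHs m.+1) (IHs m) opprK mulrN mulr_sumr.
  rewrite big_nat_recr//= [X in _ = X - _]big_nat_recr//= subnn L0 addrAC; congr (_ + _).
  rewrite -sumrB !big_nat; apply: eq_bigr => i /andP[_ i_m].
  by rewrite subSn// LE /p; ring.
under eq_bigr => i _ do rewrite big_cons mulrDl.
by rewrite big_split /= tele shift LE -[n.+1]addn1 natrD; ring.
Qed.

Lemma reciprocal_roots_exist (L : {poly algC}) : L`_0 = 1 ->
  exists2 ws, L = \prod_(w <- ws) (1 - w *: 'X) & size ws = (size L).-1.
Proof.
move=> L0; have [rs LE] := closed_field_poly_normal L.
have Ln0 : L != 0 by apply: contra_eq_neq L0 => ->; rewrite coef0 eq_sym oner_eq0.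
have rs0 : 0 \notin rs.
  apply/negP => r0; have : root L 0 by rewrite LE rootZ ?lead_coef_eq0// root_prod_XsubC.
  by rewrite /root horner_coef0 L0 oner_eq0.
exists [seq r^-1 | r <- rs]; last first.
  by rewrite size_map LE size_scale ?lead_coef_eq0// size_prod_XsubC.
rewrite big_map.
have E : \prod_(r <- rs) ('X - r%:P) = (\prod_(r <- rs) (- r))%:P * \prod_(r <- rs) (1 - r^-1 *: 'X).
  rewrite rmorph_prod -big_split /= big_seq [RHS]big_seq; apply: eq_bigr => r rI.
  have r0 : r != 0 by apply: contraNneq rs0 => <-.
  by rewrite mulrBr mulr1 mul_polyC scalerA mulNr divff// scaleN1r opprK polyCN addrC.
have P0 : (\prod_(r <- rs) (1 - r^-1 *: 'X : {poly algC}))`_0 = 1.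
  rewrite -horner_coef0 horner_prod big1// => r _.
  by rewrite hornerD hornerN hornerZ hornerX mulr0 subr0 hornerC.
move: L0; rewrite [in X in X -> _]LE E coefZ coefCM P0 mulr1 => Lc.
by rewrite [LHS]LE E mul_polyC scalerA Lc scale1r.
Qed.

(* [A n] are the coefficients of the L-function and [S n] the power sums of its
   reciprocal roots up to sign.  As [\sum_n A n = 0], one of the at most [k - 1]
   reciprocal roots is 1, and it cancels the 1 in [1 + S 1]. *)
Lemma first_power_sum_bound (A S : nat -> algC) (k : nat) (rho C : algC) n0 :
  A 0%N = 1 -> (forall n, (k <= n)%N -> A n = 0) -> \sum_(n < k) A n = 0 ->
  (forall n, n%:R * A n = \sum_(1 <= i < n.+1) S i * A (n - i)%N) ->
  0 < rho -> (forall n, (n0 <= n)%N -> `|S (2 * n)%N| <= C * (rho ^+ 2) ^+ n) ->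
  `|1 + S 1%N| <= (k - 2)%:R * rho.
Proof.
move=> A0 Ak sumA rec rho0 SB.
pose L : {poly algC} := \poly_(n < k) A n.
have LA n : L`_n = A n by rewrite coef_poly; case: ltnP => // /Ak.
have [ws LE szws] : exists2 ws, L = \prod_(w <- ws) (1 - w *: 'X) & size ws = (size L).-1.
  by apply: reciprocal_roots_exist; rewrite LA A0.
have w1 : 1 \in ws.
  have : L.[1] = 0 by rewrite horner_poly -[RHS]sumA; apply: eq_bigr => i _; rewrite expr1n mulr1.
  rewrite LE horner_prod => /eqP; rewrite prodf_seq_eq0 => /hasP[w wI].
  by rewrite !hornerE /= subr_eq0 => /eqP ->.
have SE n : (0 < n)%N -> S n = - \sum_(w <- ws) w ^+ n.
  elim/ltn_ind: n => n IHn n_gt0.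
  have := newton_power_sums ws n; rewrite /= -LE LA (rec n).
  rewrite big_nat_recr//= [X in _ = - X]big_nat_recr//= subnn A0 LA A0 !mulr1 opprD.
  rewrite big_nat (eq_bigr (fun i => - ((\sum_(w <- ws) w ^+ i) * L`_(n - i)))).
    by rewrite -big_nat sumrN => /addrI.
  by move=> i /andP[i_gt0 i_n]; rewrite IHn// LA mulNr.
have wB w : w \in ws -> `|w| <= rho.
  (* Only even power sums are controlled, and these are the power sums of the squares. *)
  move=> wI; have : `|w ^+ 2| <= rho ^+ 2.
    apply: (@power_sums_bound [seq w ^+ 2 | w <- ws] C _ n0.+1) (map_f _ wI).
      by rewrite exprn_gt0.
    move=> n n_ge; rewrite big_map.
    under eq_bigr => y _ do rewrite -exprM.
    have : (n0 <= n)%N by apply: ltnW.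
    by move=> /SB; rewrite SE ?muln_gt0 ?(leq_ltn_trans _ n_ge)// normrN.
  by rewrite normrX ler_pXn2r ?nnegrE //; exact: ltW.
have szL : (size L <= k)%N by apply: size_poly.
rewrite SE// (perm_big _ (perm_to_rem w1)) /= big_cons.
rewrite (eq_bigr id); last by move=> w _; rewrite expr1.
rewrite expr1 opprD addNKr normrN.
apply: (le_trans (ler_norm_sum _ _ _)).
apply: (@le_trans _ _ (\sum_(w <- rem 1 ws) rho)).
  by rewrite big_seq [leRHS]big_seq; apply: ler_sum => w /mem_rem/wB.
rewrite big_const_seq count_predT iter_addr addr0 size_rem// szws mulr_natl.
by rewrite ler_wpMn2l ?ltW//; lia.
Qed.

(** * The Weil bound for products of multiplicative characters *)

Lemma expf_card_pred (F : finFieldType) (x : F) : x != 0 -> x ^+ #|F|.-1 = 1.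
Proof.
move=> x0; apply: (mulfI x0); rewrite -exprS prednK ?expf_card ?mulr1//.
exact: ltnW (finNzRing_gt1 F).
Qed.

Lemma finField_prim_root_exists (F : finFieldType) :
  exists z : F, #|F|.-1.-primitive_root z.
Proof.
have q1 : (0 < #|F|.-1)%N by have := finNzRing_gt1 F; case: #|F| => [|[]].
have /hasP[z _ zP] : has #|F|.-1.-primitive_root (enum [pred x : F | x != 0]).
  apply: has_prim_root => //.
  - by apply/allP => x; rewrite mem_enum inE unity_rootE => /expf_card_pred ->.
  - exact: enum_uniq.
  rewrite -cardE (cardD1 0) inE.
  by rewrite leq_eqVlt; apply/orP; left; apply/eqP/eq_card => x; rewrite !inE andbT.
by exists z.
Qed.

(** By injectivity [W ^+ j] is trivial on nonzero elements exactly when [q - 1] divides [j], so a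
    single [W] provides all characters. Its zeroth power takes the value 1 at 0 as well. *)
Lemma mult_char_exists (F : finFieldType) :
  exists W : F -> algC, [/\ W 0 = 0, W 1 = 1, {morph W : x y / x * y} & injective W].
Proof.
have [z zP] := finField_prim_root_exists F; set N := #|F|.-1 in zP.
have [w wP] := C_prim_root_exists (prim_order_gt0 zP).
have /choice[l lE] : forall x : F, exists i : nat, x != 0 -> x = z ^+ i.
  move=> x; have [->|x0] := eqVneq x 0; first by exists 0%N.
  have /(prim_rootP zP)[i ->] : x ^+ N = 1 by apply: expf_card_pred.
  by exists i.
have w0 i : w ^+ i != 0.
  apply/expf_neq0/eqP => w0; have := prim_expr_order wP.
  by rewrite w0 expr0n gtn_eqF ?(prim_order_gt0 zP)// => /eqP; rewrite eq_sym oner_eq0.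
have zw i j : (w ^+ i == w ^+ j) = (z ^+ i == z ^+ j).
  by rewrite (eq_prim_root_expr wP) (eq_prim_root_expr zP).
exists (fun x => if x == 0 then 0 else w ^+ l x); split.
- by rewrite eqxx.
- by rewrite oner_eq0; apply/eqP; have := zw (l 1) 0%N; rewrite !expr0 => ->; rewrite -lE ?oner_eq0.
- move=> x y; rewrite mulf_eq0; case: eqVneq => [_|x0]; first by rewrite mul0r.
  case: eqVneq => [_|y0]; first by rewrite mulr0.
  by apply/eqP; rewrite -exprD zw exprD -!lE// mulf_neq0.
- move=> x y; case: eqVneq => [->|x0]; case: eqVneq => [->|y0] //.
  + by move=> /esym/eqP; rewrite (negPf (w0 _)).
  + by move=> /eqP; rewrite (negPf (w0 _)).
  + by move=> /eqP; rewrite zw -!lE// => /eqP.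
Qed.

Section MultiplicativeCharacter.

Variables (F : finFieldType) (W : F -> algC).
Hypotheses (W0 : W 0 = 0) (W1 : W 1 = 1) (WM : {morph W : x y / x * y}).
Hypothesis W_inj : injective W.

Lemma char_exp x n : W (x ^+ n) = W x ^+ n.
Proof. by elim: n => [|n IHn]; rewrite ?W1// !exprS WM IHn. Qed.

Lemma char_prod (I : Type) (s : seq I) (P : pred I) (G : I -> F) :
  W (\prod_(i <- s | P i) G i) = \prod_(i <- s | P i) W (G i).
Proof. exact: (big_morph W WM W1). Qed.

Lemma norm_char x : x != 0 -> `|W x| = 1.
Proof.
move=> x0; apply/eqP; rewrite -(@pexpr_eq1 _ _ #|F|.-1)//; last first.
  by have := finNzRing_gt1 F; case: #|F| => [|[]].
by rewrite -normrX -char_exp expf_card_pred// W1 normr1.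
Qed.

Lemma sum_char_exp j : ~~ (#|F|.-1 %| j)%N -> \sum_x W x ^+ j = 0.
Proof.
move=> Nj; have [z zP] := finField_prim_root_exists F.
have z0 : z != 0.
  apply/eqP => z0; have := prim_expr_order zP; rewrite z0 expr0n.
  by rewrite gtn_eqF ?(prim_order_gt0 zP)// => /eqP; rewrite eq_sym oner_eq0.
have Wz : W z ^+ j != 1 by rewrite -char_exp -W1 (inj_eq W_inj) -(prim_order_dvd zP).
apply/eqP; rewrite -(mulrI_eq0 _ (mulfI (_ : W z ^+ j - 1 != 0))) ?subr_eq0//.
rewrite mulrBl mul1r subr_eq0 mulr_sumr [X in _ == X](reindex (fun x => z * x)); last first.
  by exists (fun x => z^-1 * x) => x _; rewrite ?mulKf ?mulVKf.
by apply/eqP/eq_bigr => x _; rewrite WM exprMn.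
Qed.

Lemma sum_char_roots_of_unity d : (1 < d)%N -> (d %| #|F|.-1)%N ->
  \sum_(x | x ^+ d == 1) W x = 0.
Proof.
move=> d_gt1 dq; have [z zP] := finField_prim_root_exists F.
have yP := dvdn_prim_root zP dq.
set y := z ^+ _ in yP.
have y0 : y != 0.
  apply/eqP => y0; have := prim_expr_order yP; rewrite y0 expr0n.
  by rewrite gtn_eqF ?(prim_order_gt0 yP)// => /eqP; rewrite eq_sym oner_eq0.
have Wy : W y != 1.
  by rewrite -W1 (inj_eq W_inj) -(expr1 y) -(prim_order_dvd yP) gtnNdvd.
apply/eqP; rewrite -(mulrI_eq0 _ (mulfI (_ : W y - 1 != 0))) ?subr_eq0//.
rewrite mulrBl mul1r subr_eq0 mulr_sumr [X in _ == X](reindex (fun x => y * x)); last first.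
  by exists (fun x => y^-1 * x) => x _; rewrite ?mulKf ?mulVKf.
apply/eqP/eq_big => x; first by rewrite exprMn (prim_expr_order yP) mul1r.
by move=> _; rewrite WM.
Qed.

End MultiplicativeCharacter.

(** * The L-function attached to a product of characters *)

Section CharacterLFunction.

Variables (F : finFieldType) (W : F -> algC).
Hypotheses (W0 : W 0 = 0) (W1 : W 1 = 1) (WM : {morph W : x y / x * y}).
Hypothesis W_inj : injective W.
Variables (I : finType) (b : I -> F) (j : I -> nat).
Hypotheses (b_inj : injective b) (jN : forall i, ~~ (#|F|.-1 %| j i)%N).
Hypothesis j_sum : (#|F|.-1 %| \sum_i j i)%N.
Variable i0 : I.
Let k := #|I|.
Let q := #|F|.

(** A Dirichlet character modulo [prod_i (X - b i)]; its values at the [X - a] are the terms of the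
    character sum. *)
Definition char_lam (g : {poly F}) : algC := \prod_i W g.[b i] ^+ j i.

Let j_gt0 i : (0 < j i)%N.
Proof. by rewrite lt0n; apply: contraNneq (jN i) => ->; rewrite dvdn0. Qed.

Let k_gt0 : (0 < k)%N. Proof. by rewrite /k (cardD1 i0). Qed.

Lemma char_lamE g : char_lam g = W (\prod_i g.[b i] ^+ j i).
Proof.
by rewrite char_prod//; apply: eq_bigr => i _; rewrite char_exp.
Qed.

Lemma char_lam1 : char_lam 1 = 1.
Proof. by apply: big1 => i _; rewrite hornerC W1 expr1n. Qed.

Lemma char_lamM : {morph char_lam : g h / g * h}.
Proof.
move=> g h; rewrite /char_lam -big_split; apply: eq_bigr => i _.
by rewrite hornerM WM exprMn.
Qed.

Lemma char_lam0 : char_lam 0 = 0.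
Proof.
by rewrite /char_lam (bigD1 i0)//= horner0 W0 expr0n gtn_eqF ?mul0r.
Qed.

Lemma char_lamZ c g : c != 0 -> char_lam (c *: g) = char_lam g.
Proof.
move=> c0; rewrite !char_lamE; congr W.
under eq_bigr => i _ do rewrite hornerZ exprMn.
rewrite big_split /= -expr_sum; have /dvdnP[m ->] := j_sum.
by rewrite mulnC exprM expf_card_pred// expr1n mul1r.
Qed.

Let h := \prod_(i | i != i0) ('X - (b i)%:P).

Let hE i : (h.[b i] == 0) = (i != i0).
Proof.
rewrite horner_prod; apply/prodf_eq0/idP => [[i' i'0]|ii0].
  by rewrite hornerXsubC subr_eq0 (inj_eq b_inj) => /eqP->.
by exists i => //; rewrite hornerXsubC subrr.
Qed.

Let size_h : size h = k.
Proof.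
rewrite size_prod => [|i _]; last by rewrite polyXsubC_eq0.
under eq_bigr => i _ do rewrite size_XsubC.
rewrite sum_nat_const muln2 -addnn -addSn addnK.
rewrite -[RHS](prednK k_gt0) /k -(cardC1 i0); congr S; exact: eq_card.
Qed.

(* [h] vanishes at all the [b i] except [b i0], so that translating by multiples of
   [h] averages the character of order [j i0] over the whole field. *)
Lemma sum_char_lam_translates (s : seq {poly F}) :
  uniq s -> (forall g t, g \in s -> g + t *: h \in s) -> \sum_(g <- s) char_lam g = 0.
Proof.
move=> us sh; set S := \sum_(g <- s) _.
have St t : \sum_(g <- s) char_lam (g + t *: h) = S.
  rewrite -(big_map (fun g => g + t *: h) xpredT char_lam); apply: perm_big.
  apply: uniq_perm => //; first by rewrite map_inj_uniq// => x y /addIr.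
  move=> g; apply/mapP/idP => [[g' g's ->]|gs]; first exact: sh.
  by exists (g + (- t) *: h); [exact: sh|rewrite scaleNr subrK].
have q0 : (#|F|%:R : algC) != 0 by rewrite pnatr_eq0 -lt0n (ltnW (finNzRing_gt1 F)).
apply: (mulfI q0); rewrite mulr0 mulr_natl -sumr_const.
rewrite (eq_bigr (fun t => \sum_(g <- s) char_lam (g + t *: h))); last by move=> t _; rewrite St.
rewrite exchange_big big1// => g _.
have h0 : h.[b i0] != 0 by rewrite hE eqxx.
have E t : char_lam (g + t *: h) =
    (\prod_(i | i != i0) W g.[b i] ^+ j i) * W (g.[b i0] + t * h.[b i0]) ^+ j i0.
  rewrite /char_lam (bigD1 i0)//= mulrC !hornerE; congr (_ * _).
  apply: eq_bigr => i ii0; rewrite !hornerE.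
  by have /eqP-> : h.[b i] == 0; rewrite ?hE// mulr0 addr0.
under eq_bigr => t _ do rewrite E.
rewrite -mulr_sumr -(_ : \sum_x W x ^+ j i0 = \sum_t W (g.[b i0] + t * h.[b i0]) ^+ j i0).
  by rewrite sum_char_exp ?mulr0.
rewrite [LHS](reindex (fun t => g.[b i0] + t * h.[b i0]))//.
exists (fun x => (x - g.[b i0]) / h.[b i0]) => x _.
  by rewrite addrC addKr mulfK.
by rewrite divfK// addrC subrK.
Qed.

Lemma char_monic_sum_eq0 n : (k <= n)%N -> monic_sum char_lam n = 0.
Proof.
move=> kn; apply: sum_char_lam_translates; first exact: monics_uniq.
move=> g t; rewrite !mem_monics => /andP[gm /eqP szg].
have lt : (size (t *: h) < size g)%N.
  by rewrite szg ltnS (leq_trans (size_scale_leq _ _))// size_h.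
by rewrite monicE lead_coefDl// size_polyDl// szg eqxx andbT -monicE.
Qed.

(** All polynomials of degree less than [k] are stable under translation by multiples of [h], so the
    character sums to 0 over them. Each nonzero one is a scalar times a monic one and the character
    ignores scalars, so this sum is [q - 1] times the one sought. *)
Lemma sum_char_monic_sum : \sum_(n < k) monic_sum char_lam n = 0.
Proof.
pose us := [seq c <- enum F | c != 0].
pose ms := flatten [seq monics F n | n <- iota 0 k].
have ms_mem (g : {poly F}) : (g \in ms) = (g \is monic) && (size g <= k)%N.
  apply/flatten_mapP/andP => [[n]|[gm szg]].
    by rewrite mem_iota mem_monics => nk /andP[-> /eqP ->].
  exists (size g).-1; first by rewrite mem_iota /= prednK ?size_poly_gt0 ?monic_neq0.
  by rewrite mem_monics gm prednK ?size_poly_gt0 ?monic_neq0 ?eqxx.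
have ms_uniq : uniq ms.
  rewrite /ms; elim: (iota 0 k) (iota_uniq 0 k) => //= n s IHs /andP[ns us'].
  rewrite cat_uniq monics_uniq IHs// andbT; apply/hasPn => g /flatten_mapP[n' n's].
  rewrite !mem_monics => /andP[_ /eqP ->]; apply/negP => /andP[_ /eqP[nn]].
  by rewrite -nn n's in ns.
pose s := 0 :: [seq c *: g | c <- us, g <- ms].
have s_mem (g : {poly F}) : (g \in s) = (size g <= k)%N.
  rewrite inE; have [->|g0] /= := eqVneq g 0; first by rewrite size_poly0.
  apply/allpairsP/idP => [[[c m]] /= [cI mI ->]|szg].
    by move: mI; rewrite ms_mem => /andP[_]; apply: leq_trans; apply: size_scale_leq.
  have lg0 : lead_coef g != 0 by rewrite lead_coef_eq0.
  exists (lead_coef g, (lead_coef g)^-1 *: g); split => /=.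
  - by rewrite mem_filter lg0 mem_enum.
  - by rewrite ms_mem monicE lead_coefZ mulVf// eqxx size_scale ?invr_eq0.
  - by rewrite scalerA divff// scale1r.
have s_uniq : uniq s.
  have us_uniq : uniq us by apply: filter_uniq; exact: enum_uniq.
  rewrite /s cons_uniq allpairs_uniq//.
    rewrite andbT; apply/allpairsP => -[[c m]] /= [cI mI /esym/eqP].
    move: cI mI; rewrite mem_filter ms_mem => /andP[c0 _] /andP[mm _].
    by rewrite scaler_eq0 (negPf c0) (negPf (monic_neq0 mm)).
  move=> [c m] [c' m'] /allpairsP[[? ?] /= [cI mI [-> ->]]] /allpairsP[[? ?] /= [c'I m'I [-> ->]]].
  move: cI c'I mI m'I; rewrite !mem_filter !ms_mem => /andP[c0 _] /andP[c'0 _] /andP[/monicP mm _] /andP[/monicP mm' _] /= E.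
  have := congr1 lead_coef E; rewrite !lead_coefZ mm mm' !mulr1 => Ec.
  by rewrite Ec in E *; congr pair; apply: (scalerI c'0 E).
have : \sum_(g <- s) char_lam g = 0.
  apply: sum_char_lam_translates => // g t; rewrite !s_mem => szg.
  rewrite (leq_trans (size_polyD _ _))// geq_max szg.
  by rewrite (leq_trans (size_scale_leq _ _))// size_h.
rewrite /s big_cons char_lam0 add0r big_allpairs_dep /= big_seq.
rewrite (eq_bigr (fun=> \sum_(g <- ms) char_lam g)); last first.
  move=> c; rewrite mem_filter => /andP[c0 _].
  by apply: eq_bigr => g _; rewrite char_lamZ.
rewrite -big_seq big_const_seq count_predT iter_addr addr0 => /eqP.
rewrite mulrn_eq0 => /orP[|/eqP E]; last first.
  rewrite -(big_mkord xpredT (fun n => monic_sum char_lam n)) /index_iota subn0 -[RHS]E.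
  by rewrite big_flatten /= big_map.
rewrite size_eq0 => /eqP us0.
have : 1 \in us by rewrite mem_filter oner_eq0 mem_enum.
by rewrite us0.
Qed.

Lemma von_mangoldt_sum_one :
  von_mangoldt_sum char_lam 1 = \sum_a \prod_i W (b i - a) ^+ j i.
Proof.
rewrite von_mangoldt_sumE// /irreds_dvd /= cats0.
rewrite (perm_big [seq 'X - a%:P | a <- enum F]) /=.
  rewrite big_map big_enum /=; apply: eq_bigr => a _; rewrite size_XsubC mul1r divn1 expr1.
  by apply: eq_bigr => i _; rewrite hornerXsubC.
apply: uniq_perm; first by rewrite filter_uniq ?monics_uniq.
  by rewrite map_inj_uniq ?enum_uniq// => x y /addrI/oppr_inj/polyC_inj.
move=> p; apply/idP/mapP => [/mem_irreds[pm _ szp]|[a _ ->]].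
  exists (- p`_0); rewrite ?mem_enum// polyCN opprK.
  apply/polyP => i; rewrite coefD coefX coefC; case: i => [|[|i]] /=; rewrite ?add0r ?addr0//.
    by move/monicP: pm; rewrite lead_coefE szp.
  by rewrite nth_default// szp.
by apply: irredsP; [exact: monicXsubC|exact: irredp_XsubC|exact: size_XsubC].
Qed.
End CharacterLFunction.

(** * Points of even extensions sorted by the value of the character *)

Lemma mup_exp (F : fieldType) (x : F) (p : {poly F}) n :
  p != 0 -> mup x (p ^+ n) = (n * mup x p)%N.
Proof.
move=> p0; elim: n => [|n IHn]; first by rewrite expr0 mupNroot// root1.
by rewrite exprS mupM ?expf_neq0// IHn mulSn.
Qed.

Lemma mup_prod_XsubCX (F : fieldType) (I : finType) (b : I -> F) (j : I -> nat) i :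
  injective b -> mup (b i) (\prod_i ('X - (b i)%:P) ^+ j i) = j i.
Proof.
move=> b_inj; rewrite (bigD1 i)//= mupMl ?mup_XsubCX ?eqxx//.
rewrite /root horner_prod; apply/prodf_neq0 => i' i'i.
by rewrite horner_exp hornerXsubC expf_neq0// subr_eq0 (inj_eq b_inj) eq_sym.
Qed.

Section CharacterSumBound.

Variables (F : finFieldType) (W : F -> algC).
Hypotheses (W0 : W 0 = 0) (W1 : W 1 = 1) (WM : {morph W : x y / x * y}).
Hypothesis W_inj : injective W.
Variables (I : finType) (b : I -> F) (j : I -> nat).
Hypotheses (b_inj : injective b) (jN : forall i, ~~ (#|F|.-1 %| j i)%N).
Hypothesis b_neq0 : forall i, b i != 0.
Hypothesis j_sum : (#|F|.-1 %| \sum_i j i)%N.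
Variable i0 : I.
Let k := #|I|.
Let q := #|F|.

(** Dividing the exponents by their common divisor with [q - 1] leaves a product of exact order [d],
    whose Kummer curve [y^d = f] is irreducible. *)
Let g0 := gcdn q.-1 (\big[gcdn/0%N]_i j i).
Let d := (q.-1 %/ g0)%N.
Let j' i := (j i %/ g0)%N.

Let q1_gt0 : (0 < q.-1)%N.
Proof. by rewrite /q; have := finNzRing_gt1 F; case: #|F| => [|[]]. Qed.
Let g0_gt0 : (0 < g0)%N. Proof. by rewrite gcdn_gt0 q1_gt0. Qed.
Let g0_j i : (g0 %| j i)%N.
Proof. exact: dvdn_trans (dvdn_gcdr _ _) (biggcdn_inf _ _ (dvdnn _)). Qed.
Let jE i : j i = (j' i * g0)%N. Proof. by rewrite divnK. Qed.
Let qE : q.-1 = (d * g0)%N. Proof. by rewrite divnK// dvdn_gcdl. Qed.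
Let d_q : (d %| q.-1)%N. Proof. by rewrite qE dvdn_mulr. Qed.
Let d_gt1 : (1 < d)%N.
Proof.
have d_gt0 : (0 < d)%N by rewrite divn_gt0// dvdn_leq// dvdn_gcdl.
rewrite ltn_neqAle d_gt0 andbT; apply/eqP => d1.
by have := jN i0; rewrite -/q qE -d1 mul1n g0_j.
Qed.

Let f0 : {poly F} := \prod_i ('X - (b i)%:P) ^+ j' i.
Let f0_neq0 : f0 != 0.
Proof. by apply/prodf_neq0 => i _; rewrite expf_neq0// polyXsubC_eq0. Qed.
Let f00 : f0.[0] != 0.
Proof.
rewrite horner_prod; apply/prodf_neq0 => i _.
by rewrite horner_exp hornerXsubC sub0r expf_neq0// oppr_eq0.
Qed.
Let f := f0.[0]^-1 *: f0.

(** Comparing multiplicities at [b i] shows that [t] divides every [j' i]; then [t * g0] divides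
    [q - 1] and every [j i], hence [g0]. *)
Let f_nopower t (u v : {poly F}) : (t %| d)%N -> v != 0 -> f * v ^+ t = u ^+ t -> t = 1%N.
Proof.
move=> td v0 E.
have f_neq0 : f != 0 by rewrite scaler_eq0 invr_eq0 (negPf f00).
have u0 : u ^+ t != 0 by rewrite -E mulf_neq0// expf_neq0.
have d_gt0 : (0 < d)%N by apply: ltnW.
have u_neq0 : u != 0.
  apply: contraNneq u0 => ->; rewrite expr0n.
  by case: t td {E} => [|t]//; rewrite dvd0n gtn_eqF.
have t_j i : (t %| j' i)%N.
  have := congr1 (mup (b i)) E; rewrite mupM ?expf_neq0// !mup_exp//.
  rewrite /f -mul_polyC mupMr; last by rewrite rootC invr_eq0.
  rewrite mup_prod_XsubCX// => Ei.
  rewrite -(@dvdn_addl (t * mup (b i) v)) ?dvdn_mulr//.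
  by rewrite Ei dvdn_mulr.
have : (t * g0 %| g0)%N.
  rewrite dvdn_gcd; apply/andP; split; first by rewrite qE dvdn_pmul2r.
  by apply/dvdn_biggcdP => i _; rewrite (jE i) dvdn_pmul2r.
by rewrite -{2}[g0]mul1n dvdn_pmul2r// dvdn1 => /eqP.
Qed.

Let cval N (p : {poly F}) : F := (\prod_i p.[b i] ^+ j i) ^+ (N %/ (size p).-1).

(* [cval N p] is the norm of [prod_i (b i - x)^(j i)] at a point [x] of degree
   dividing [N] with minimal polynomial [p]. *)
Let f0_mod N (p : {poly F}) : (0 < N)%N -> p \in irreds_dvd F N ->
  p %| f0 ^+ ((q ^ N).-1 %/ d) - (cval N p)%:P.
Proof.
move=> N_gt0 /(mem_irreds_dvd N_gt0)[pm pi szp eN].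
have [E [ev [_ evP _]]] := residue_field_exists pm pi.
rewrite -evP rmorphB subr_eq0 predn_exp qE -mulnA mulKn; last exact: ltnW.
set M := (\sum_(i < N) _)%N; set e := (size p).-1 in szp eN *.
have evb i : ev (('X - (b i)%:P) ^+ M) = ev (((-1) ^+ e * p.[b i]) ^+ (N %/ e))%:P.
  by apply/eqP; rewrite -subr_eq0 -rmorphB evP; apply: dvdp_norm_XsubC.
have -> : f0 ^+ (g0 * M) = \prod_i (('X - (b i)%:P) ^+ M) ^+ j i.
  rewrite /f0 -prodrXl; apply: eq_bigr => i _; rewrite -!exprM jE; congr (_ ^+ _).
  by rewrite mulnA mulnC.
rewrite rmorph_prod; under eq_bigr => i _ do rewrite rmorphXn evb -rmorphXn -rmorphXn.
rewrite -!rmorph_prod /cval; apply/eqP; congr (ev _%:P).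
under eq_bigr => i _ do rewrite -exprM mulnC exprM exprMn.
rewrite prodrXl big_split /=; congr (_ ^+ _).
(* The signs [(-1)^e] disappear because their total exponent is a multiple of [q - 1]. *)
rewrite -expr_sum; have /dvdnP[m ->] := j_sum.
by rewrite mulnC exprM expf_card_pred ?signr_eq0// expr1n mul1r.
Qed.


Let cval_char N p : char_lam W b j p ^+ (N %/ (size p).-1) = W (cval N p).
Proof. by rewrite (char_lamE W1 WM) -char_exp. Qed.

Let cval_root N p : cval N p != 0 -> cval N p ^+ d = 1.
Proof.
have -> : cval N p = ((\prod_i p.[b i] ^+ j' i) ^+ (N %/ (size p).-1)) ^+ g0.
  rewrite exprAC /cval; congr (_ ^+ _); rewrite -prodrXl.
  by apply: eq_bigr => i _; rewrite -exprM jE.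
move=> H; rewrite -[LHS]exprM [X in _ ^+ X]mulnC -qE expf_card_pred//.
by apply: contraNneq H => ->; rewrite expr0n gtn_eqF.
Qed.

Let sum_degree_cval0 N : (0 < N)%N ->
  (\sum_(p <- irreds_dvd F N | cval N p == 0%R) (size p).-1 <= k)%N.
Proof.
move=> N_gt0; rewrite -big_filter.
have sub : {subset [seq p <- irreds_dvd F N | cval N p == 0] <= [seq 'X - (b i)%:P | i <- enum I]}.
  move=> p; rewrite mem_filter => /andP[/eqP c0 /(mem_irreds_dvd N_gt0)[pm pi _ _]].
  have : \prod_i p.[b i] ^+ j i == 0 by apply/eqP; move/eqP: c0; rewrite expf_eq0 => /andP[_ /eqP].
  rewrite prodf_seq_eq0 => /hasP[i _]; rewrite /= expf_eq0 => /andP[_ pb].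
  apply/mapP; exists i; first by rewrite mem_enum.
  have : 'X - (b i)%:P %| p by rewrite dvdp_XsubCl.
  move=> /(pi.2 _ (_ : size ('X - (b i)%:P) != 1)); rewrite size_XsubC => /(_ isT) E.
  by apply/esym/eqP; rewrite -eqp_monic ?monicXsubC.
rewrite big_seq (eq_bigr (fun=> 1%N)); last first.
  by move=> p /sub/mapP[i _ ->]; rewrite size_XsubC.
rewrite -big_seq sum1_size.
have := uniq_leq_size (filter_uniq _ (irreds_dvd_uniq F N)) sub.
by rewrite size_map -cardE.
Qed.

Let sum_degree_cval : exists C n0 : nat, forall n, (n0 <= n)%N -> forall c, c != 0 ->
  (d * \sum_(p <- irreds_dvd F (2 * n) | cval (2 * n) p == c) (size p).-1
     <= (q ^ n) ^ 2 + C * q ^ n)%N.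
Proof.
have [z zP] := finField_prim_root_exists F.
have zdP := dvdn_prim_root zP d_q.
have f_0 : f.[0] = 1 by rewrite hornerZ mulVf.
have [C [n0 st]] := stepanov_bound zdP d_q f_0 f_nopower (leqSpred (size f)).
exists C, n0.+1 => n n_ge c c0; have n_gt0 : (0 < n)%N by apply: leq_trans n_ge.
have N_gt0 : (0 < 2 * n)%N by rewrite muln_gt0.
have QE : ((q ^ n) ^ 2 = q ^ (2 * n))%N by rewrite -expnM mulnC.
(* Scaling [f0] to [f] multiplies every class value by [kap]. *)
set kap := f0.[0]^-1 ^+ ((q ^ (2 * n)).-1 %/ d).
have kap0 : kap != 0 by rewrite expf_neq0// invr_eq0.
have [|phi [phi0 szphi phiP]] := st n (ltnW n_ge) (kap * c); first by rewrite mulf_neq0.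
apply: leq_trans szphi; rewrite leq_mul2l; apply/orP; right.
rewrite -big_filter; set s := [seq p <- _ | _].
have s_uniq : uniq s by rewrite filter_uniq ?irreds_dvd_uniq.
have sP p : p \in s -> [/\ p \is monic, irreducible_poly p & p %| phi].
  rewrite mem_filter => /andP[/eqP cE pI].
  have [pm pi szp eN] := mem_irreds_dvd N_gt0 pI; split=> //.
  apply: phiP => //; rewrite QE; first exact: (dvdp_Xcard_sub_X pm pi szp).
  have -> : f ^+ ((q ^ (2 * n)).-1 %/ d) - (kap * c)%:P =
      kap *: (f0 ^+ ((q ^ (2 * n)).-1 %/ d) - (cval (2 * n) p)%:P).
    by rewrite /f exprZn cE scalerBr -/kap scale_polyC.
  by rewrite dvdpZr ?f0_mod.
have : \prod_(p <- s) p %| phi.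
  apply: dvdp_prod_coprime => // [p p' ps p's pp'|p /sP[]//].
  have [[pm pi _] [pm' pi' _]] := (sP _ ps, sP _ p's).
  apply: coprimep_irreducible => //; apply: contra pp' => Epp.
  by rewrite -eqp_monic.
move=> /(dvdp_leq phi0); apply: leq_trans.
rewrite size_prod_seq; last by move=> p /sP[pm _ _]; apply: monic_neq0.
have : (\sum_(p <- s) size p = \sum_(p <- s) (size p).-1 + size s)%N.
  rewrite -[size s]sum1_size -big_split /= big_seq [RHS]big_seq; apply: eq_bigr => p /sP[pm _ _].
  by rewrite addn1 prednK// size_poly_gt0 monic_neq0.
by move=> ->; rewrite -addSn addnK leqnSn.
Qed.

(* An upper bound for the number of points in each class [c] is enough: since
   [\sum_c W c = 0], one may subtract it from all the counts, and the differences
   have constant sign and a known sum. *)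
Lemma char_von_mangoldt_bound : exists (C : algC) (n0 : nat), forall n, (n0 <= n)%N ->
  `|von_mangoldt_sum (char_lam W b j) (2 * n)| <= C * q%:R ^+ n.
Proof.
have [C [n0 st]] := sum_degree_cval.
exists (C + k)%:R, n0.+1 => n n_ge; have n_gt0 : (0 < n)%N by apply: leq_trans n_ge.
have N_gt0 : (0 < 2 * n)%N by rewrite muln_gt0.
have d_gt0 : (0 < d)%N by apply: ltnW.
pose s := irreds_dvd F (2 * n).
pose Nc c := (\sum_(p <- s | cval (2 * n) p == c) (size p).-1)%N.
pose U : algC := ((q ^ n) ^ 2 + C * q ^ n)%:R / d%:R.
have Nc_eq0 c : c != 0 -> (c ^+ d == 1) = false -> Nc c = 0%N.
  move=> c0 cd; rewrite /Nc -big_filter (_ : [seq p <- s | _] = [::]) ?big_nil//.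
  apply/eqP; rewrite -[_ == _]negbK -has_filter; apply/hasPn => p _.
  by apply/negP => /eqP cE; move: cd; rewrite -cE cval_root ?eqxx// cE.
have SE : von_mangoldt_sum (char_lam W b j) (2 * n) = \sum_(c | c ^+ d == 1) W c * (Nc c)%:R.
  rewrite von_mangoldt_sumE//.
  rewrite [RHS]big_mkcond [RHS](eq_bigr (fun c => \sum_(p <- s) if cval (2 * n) p == c then (size p).-1%:R * W c else 0)).
    rewrite [RHS]exchange_big; apply: eq_bigr => p _.
    by rewrite -big_mkcond (big_pred1 (cval (2 * n) p)) ?cval_char// => c; rewrite eq_sym.
  move=> c _; rewrite -big_mkcond -mulr_suml mulrC -natr_sum -/(Nc c).
  case: ifP => // cd; have [->|c0] := eqVneq c 0; first by rewrite W0 ?mul0r ?mulr0.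
  by rewrite Nc_eq0 ?mulr0 ?mul0r.
have totE : (Nc 0%R + \sum_(c | c ^+ d == 1%R) Nc c = q ^ (2 * n))%N.
  rewrite -sum_degree_irreds_dvd//.
  transitivity (\sum_c Nc c)%N.
    rewrite [RHS](bigD1 0)//=; congr (_ + _)%N.
    rewrite [RHS](bigID (fun c => c ^+ d == 1))/= [X in (_ + X)%N]big1 ?addn0.
      apply: eq_bigl => c; rewrite andbC; case: eqP => //= cd; apply/esym.
      by apply/eqP => c0; move: cd => /eqP; rewrite c0 expr0n gtn_eqF// eq_sym oner_eq0.
    by move=> c /andP[c0 /negPf cd]; apply: Nc_eq0.
  rewrite /Nc (eq_bigr (fun c => \sum_(p <- s) if cval (2 * n) p == c then (size p).-1 else 0)%N).
    rewrite exchange_big; apply: eq_bigr => p _.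
    by rewrite -big_mkcond (big_pred1 (cval (2 * n) p))// => c; rewrite eq_sym.
  by move=> c _; rewrite -big_mkcond.
have NcU c : c ^+ d == 1 -> (Nc c)%:R <= U.
  move=> cd; have c0 : c != 0 by apply: contraTneq cd => ->; rewrite expr0n gtn_eqF// eq_sym oner_eq0.
  rewrite ler_pdivlMr ?ltr0n// -natrM ler_nat mulnC.
  exact: st (ltnW n_ge) _ c0.
have -> : von_mangoldt_sum (char_lam W b j) (2 * n) = \sum_(c | c ^+ d == 1) W c * ((Nc c)%:R - U).
  rewrite SE; under [RHS]eq_bigr => c _ do rewrite mulrBr.
  by rewrite sumrB -mulr_suml (sum_char_roots_of_unity W1 WM W_inj)// mul0r subr0.
apply: (le_trans (ler_norm_sum _ _ _)).
apply: (@le_trans _ _ (\sum_(c | c ^+ d == 1) (U - (Nc c)%:R))).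
  apply: ler_sum => c cd; have c0 : c != 0 by apply: contraTneq cd => ->; rewrite expr0n gtn_eqF// eq_sym oner_eq0.
  by rewrite normrM (norm_char W1 WM)// mul1r distrC ger0_norm// subr_ge0 NcU.
rewrite sumrB -natr_sum sumr_const.
set card := #|_|; have card_d : (card <= d)%N.
  rewrite /card cardE; apply: max_unity_roots => //; last exact: enum_uniq.
  by apply/allP => c; rewrite mem_enum unity_rootE unfold_in.
have U0 : 0 <= U by rewrite divr_ge0 ?ler0n.
(* [d U] exceeds the number [q^(2n)] of points by [C q^n], and at most [k] points have value 0. *)
apply: (@le_trans _ _ (U *+ d - (\sum_(c | c ^+ d == 1) Nc c)%:R)).
  by rewrite lerD2r ler_wpMn2l.
rewrite -[U *+ d]mulr_natr divfK ?pnatr_eq0 -?lt0n// lerBlDr -natrX -natrM -natrD ler_nat.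
have := sum_degree_cval0 N_gt0; rewrite -/s -/(Nc 0) => Nc0.
have P_gt0 : (0 < q ^ n)%N by rewrite expn_gt0 (ltnW (finNzRing_gt1 F)).
have QE : ((q ^ n) ^ 2 = q ^ (2 * n))%N by rewrite -expnM mulnC.
rewrite QE -totE mulnDl.
have : (k <= k * q ^ n)%N by rewrite leq_pmulr.
move: Nc0; move: (Nc 0) (\sum_(c | _) Nc c)%N (C * q ^ n)%N (k * q ^ n)%N k; lia.
Qed.

End CharacterSumBound.

(** The summand 1 is the value at infinity. The subtraction [#|I| - 2] is exact: a single exponent
    cannot satisfy both divisibility conditions. *)
Theorem weil_bound (F : finFieldType) (W : F -> algC) (I : finType) (b : I -> F) (j : I -> nat) :
  W 0 = 0 -> W 1 = 1 -> {morph W : x y / x * y} -> injective W ->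
  injective b -> (forall i, b i != 0) ->
  (forall i, ~~ (#|F|.-1 %| j i)%N) -> (#|F|.-1 %| \sum_i j i)%N -> (0 < #|I|)%N ->
  `|1 + \sum_a \prod_i W (b i - a) ^+ j i| <= (#|I| - 2)%:R * sqrtC #|F|%:R.
Proof.
move=> W0 W1 WM W_inj b_inj b0 jN j_sum /card_gt0P[i0 _].
rewrite -(von_mangoldt_sum_one W b j).
have [C [n0 bnd]] := char_von_mangoldt_bound W0 W1 WM W_inj b_inj jN b0 j_sum i0.
apply: (@first_power_sum_bound (monic_sum (char_lam W b j)) _ #|I| _ C n0).
- by rewrite /monic_sum monics0 big_seq1 char_lam1.
- exact: (char_monic_sum_eq0 W1 WM W_inj b_inj jN i0).
- exact: (sum_char_monic_sum W0 W1 WM W_inj b_inj jN j_sum i0).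
- by apply: monic_sum_recurrence; [exact: char_lam1|exact: char_lamM].
- by rewrite sqrtC_gt0 ltr0n (ltnW (finNzRing_gt1 F)).
- by move=> n /bnd; rewrite sqrtCK.
Qed.

(** * Counting permutation binomials *)

Lemma expr_coprime_eq1 (F : fieldType) (x : F) n s :
  (0 < n)%N -> coprime n s -> x ^+ n = 1 -> x ^+ s = 1 -> x = 1.
Proof.
move=> n_gt0 /eqP cop xn xs; case: (egcdnP s n_gt0) => km kn E _.
have := congr1 (fun i => x ^+ i) E; rewrite cop exprD mulnC exprM xn expr1n.
by rewrite mulnC exprM xs expr1n mul1r expr1.
Qed.

Section PermutationBinomial.

Variables (F : finFieldType) (r s e n : nat).
Hypothesis qE : #|F|.-1 = (r * s)%N.
Hypothesis n_cop : coprime n s.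
Hypothesis n_gt0 : (0 < n)%N.

Let V : finType := {u : F | u ^+ r == 1}.

Let rs_gt0 : (0 < r * s)%N.
Proof. by rewrite -qE; have := finNzRing_gt1 F; case: #|F| => [|[]]. Qed.
Let r_gt0 : (0 < r)%N. Proof. by move: rs_gt0; rewrite muln_gt0 => /andP[]. Qed.
Let s_gt0 : (0 < s)%N. Proof. by move: rs_gt0; rewrite muln_gt0 => /andP[]. Qed.

Lemma card_unity_roots : #|V| = r.
Proof.
have [z zP] := finField_prim_root_exists F.
have yP : r.-primitive_root (z ^+ (#|F|.-1 %/ r)).
  by apply: (dvdn_prim_root zP); rewrite qE dvdn_mulr.
set y := z ^+ _ in yP.
rewrite card_sig -[RHS]card_ord -(card_codom (f := fun i : 'I_r => y ^+ i)); last first.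
  move=> i i' /eqP; rewrite (eq_prim_root_expr yP) !modn_small// => /eqP.
  exact: val_inj.
apply: eq_card => x; rewrite !inE; apply/eqP/codomP => [|[i ->]].
  by move=> /(prim_rootP yP)[i ->]; exists i.
by rewrite exprAC (prim_expr_order yP) expr1n.
Qed.

Let valV (u : V) : val u ^+ r = 1. Proof. exact/eqP/(valP u). Qed.
Let valV0 (u : V) : val u != 0.
Proof.
by apply/eqP => u0; have := valV u; rewrite u0 expr0n gtn_eqF// => /eqP; rewrite eq_sym oner_eq0.
Qed.

Lemma unity_roots_sth_power (u : F) : u ^+ r = 1 -> exists2 x, x != 0 & u = x ^+ s.
Proof.
move=> ur; have [z zP] := finField_prim_root_exists F.
have z0 : z != 0 by apply: contra_eq_neq (prim_expr_order zP) => ->; rewrite expr0n gtn_eqF ?(prim_order_gt0 zP)// eq_sym oner_eq0.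
have uq : u ^+ #|F|.-1 = 1 by rewrite qE exprM ur expr1n.
have [i uE] := prim_rootP zP uq.
have : (r * s %| i * r)%N by rewrite -qE (prim_order_dvd zP) exprM -uE ur.
rewrite mulnC dvdn_pmul2r// => /dvdnP[k iE].
by exists (z ^+ k); [rewrite expf_neq0|rewrite uE iE exprM].
Qed.

Definition binomial_factor (a : F) (u : V) : F := (val u ^+ e + a) ^+ s.

Definition good (a : F) : bool :=
  [forall u : V, val u ^+ e + a != 0] && injectiveb (fun u : V => val u ^+ n * binomial_factor a u).

(** With [f(x) = x^n ((x^s)^e + a)], the [s]-th power of [f(x)] depends only on [u = x^s]. The
    fibres of [x |-> x^s] are cosets of the [s]-th roots of unity, on which [f] acts through the
    [n]-th power, a bijection as [gcd(n, s) = 1]. Nonvanishing of [u^e + a] keeps 0 the only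
    root. *)
Lemma permutes_good (a : F) : permutes ('X^(n + e * s) + a *: 'X^n) <-> good a.
Proof.
pose f x := x ^+ n * ((x ^+ s) ^+ e + a).
have fE x : ('X^(n + e * s) + a *: 'X^n).[x] = f x.
  by rewrite !hornerE /f -exprM mulrDr -exprD [(s * e)%N]mulnC [a * _]mulrC.
have rootV (x : F) (x0 : x != 0) : (x ^+ s) ^+ r == 1.
  by have := expf_card_pred x0; rewrite qE mulnC exprM => ->.
pose pw (x : F) x0 : V := exist (fun u : F => u ^+ r == 1) (x ^+ s) (rootV x x0).
have f0 : f 0 = 0 by rewrite /f expr0n gtn_eqF// mul0r.
have fs (x : F) (x0 : x != 0) : f x ^+ s = val (pw x x0) ^+ n * binomial_factor a (pw x x0).
  by rewrite /f /binomial_factor /= exprMn; congr (_ * _); rewrite exprAC.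
have surj (u : V) : exists (x : F) (x0 : x != 0), u = pw x x0.
  have [x x0 uE] := unity_roots_sth_power (valV u).
  by exists x, x0; apply: val_inj.
rewrite /permutes; under eq_fun do rewrite fE.
split => [/bij_inj f_inj|/andP[/forallP nz /injectiveP G_inj]].
  have f_neq0 (x : F) : x != 0 -> f x != 0.
    by move=> x0; apply: contra_neq x0 => fx; apply: f_inj; rewrite fx f0.
  apply/andP; split.
    apply/forallP => u; have [x [x0 ->]] := surj u.
    by have := f_neq0 _ x0; rewrite /f mulf_eq0 negb_or => /andP[].
  apply/injectiveP => u u'; have [x [x0 ->]] := surj u; have [y [y0 ->]] := surj u'.
  rewrite -!fs => E; apply: val_inj => /=.
  pose eta := f y / f x.
  have eta_s : eta ^+ s = 1 by rewrite expr_div_n E divff// expf_neq0// f_neq0.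
  case: (egcdnP s n_gt0) => km kn Ek _; move/eqP: n_cop => n_cop'; rewrite n_cop' in Ek.
  pose theta := eta ^+ km.
  have theta_s : theta ^+ s = 1 by rewrite /theta exprAC eta_s expr1n.
  have theta_n : theta ^+ n = eta.
    by rewrite /theta -exprM Ek exprD mulnC exprM eta_s expr1n mul1r expr1.
  have : f (theta * x) = f y.
    rewrite -[RHS](divfK (f_neq0 x x0)) -/eta.
    by rewrite /f !exprMn theta_s theta_n expr1n mul1r -mulrA.
  by move/f_inj => <-; rewrite exprMn theta_s mul1r.
have f_neq0 (x : F) : x != 0 -> f x != 0.
  by move=> x0; rewrite mulf_neq0 ?expf_neq0// (nz (pw x x0)).
apply: injF_bij => x y E.
have [x0|x0] := eqVneq x 0.
  apply/eqP; rewrite x0 eq_sym; apply/negPn/negP => /f_neq0.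
  by rewrite -E x0 f0 eqxx.
have y0 : y != 0 by apply: contraNneq (f_neq0 _ x0) => y0; rewrite E y0 f0.
have : pw x x0 = pw y y0 by apply: G_inj; rewrite -!fs E.
move=> /(congr1 val) /= xys.
move: E; rewrite /f xys => /mulIf xyn.
have {}xyn : x ^+ n = y ^+ n by apply: xyn; apply: (nz (pw y y0)).
apply/eqP; rewrite -subr_eq0 -(mulrI_eq0 _ (mulfI (_ : y^-1 != 0))) ?invr_eq0//.
rewrite mulrBr mulVf// subr_eq0 mulrC; apply/eqP; apply: (expr_coprime_eq1 n_gt0 n_cop).
  by rewrite expr_div_n xyn divff// expf_neq0.
by rewrite expr_div_n xys divff// expf_neq0.
Qed.

Definition twisted_count (c : V -> F) : nat :=
  \sum_(lam : V) #|[pred a | [forall u : V, binomial_factor a u == (val lam * c u)%R]]|%N.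

(** For good [a] the only possible [pi] is [lam^-1] times the permutation [u |-> u^n (u^e + a)^s].
    Every good [a] is thus counted once for each of the [r] scalars. *)
Lemma sum_perm_factor (a : F) (lam : V) :
  (\sum_(pi : {perm V}) [forall u : V,
     binomial_factor a u == (val lam * (val (pi u) / val u ^+ n))%R] = good a)%N.
Proof.
pose G (u : V) : F := (val lam)^-1 * (val u ^+ n * binomial_factor a u).
have condE (pi : {perm V}) : [forall u : V,
    binomial_factor a u == val lam * (val (pi u) / val u ^+ n)] =
    [forall u : V, val (pi u) == G u].
  apply: eq_forallb => u; rewrite /G; apply/eqP/eqP => [->|->]; field;
  by rewrite ?expf_neq0 ?valV0.
under eq_bigr => pi _ do rewrite condE.
have [/andP[/forallP nz /injectiveP G_inj]|Ngood] := boolP (good a).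
  have inV u : G u ^+ r == 1.
    rewrite /G exprMn exprVn valV invr1 mul1r exprMn exprAC valV expr1n mul1r.
    have := expf_card_pred (nz u); rewrite qE mulnC exprM => E.
    exact/eqP.
  pose g u : V := exist (fun u : F => u ^+ r == 1) (G u) (inV u).
  have g_inj : injective g.
    move=> u u' /(congr1 val) /= /(mulfI _) E; apply: G_inj; apply: E.
    by rewrite invr_eq0 valV0.
  rewrite (eq_bigr (fun pi => nat_of_bool (pi == perm g_inj))).
    by rewrite (bigD1 (perm g_inj))//= eqxx big1 ?addn0// => pi /negPf->.
  move=> pi _; congr nat_of_bool; apply/forallP/eqP => [E|-> u].
    by apply/permP => u; rewrite permE; apply: val_inj; apply/eqP/E.
  by rewrite permE.
rewrite big1// => pi _; apply/eqP; rewrite eqb0; apply: contra Ngood => /forallP E.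
apply/andP; split.
  apply/forallP => u; have := valV0 (pi u); rewrite (eqP (E u)) /G.
  rewrite !mulf_eq0 !negb_or => /and3P[_ _].
  by rewrite /binomial_factor expf_eq0 s_gt0.
apply/injectiveP => u u' Euu'; apply: (@perm_inj _ pi); apply: val_inj.
by rewrite (eqP (E u)) (eqP (E u')) /G Euu'.
Qed.

Lemma count_good :
  (r * #|good| = \sum_(pi : {perm V}) twisted_count (fun u => (val (pi u) / val u ^+ n)%R))%N.
Proof.
rewrite -[X in (X * _)%N = _]card_unity_roots /twisted_count exchange_big -sum_nat_const /=.
apply: eq_bigr => lam _.
rewrite (eq_bigr (fun pi : {perm V} => \sum_a nat_of_bool [forall u : V,
   binomial_factor a u == (val lam * (val (pi u) / val u ^+ n))%R])%N).
  rewrite exchange_big /= -sum1_card big_mkcond /=; apply: eq_bigr => a _.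
  by rewrite sum_perm_factor -topredE /=; case: (good a).
by move=> pi _; rewrite -sum1_card big_mkcond; apply: eq_bigr => a _; rewrite inE; case: ifP.
Qed.

End PermutationBinomial.

(** * Expansion in characters and count of the exponent tuples *)

Section TupleCount.

Variables (F : finFieldType) (r s e : nat) (W : F -> algC).
Hypothesis qE : #|F|.-1 = (r * s)%N.
Hypothesis e_cop : coprime e r.
Hypotheses (W0 : W 0 = 0) (W1 : W 1 = 1) (WM : {morph W : x y / x * y}).
Hypothesis W_inj : injective W.

Let V : finType := {u : F | u ^+ r == 1}.
Let cardV : #|V| = r := card_unity_roots qE.
Let rs_gt0 : (0 < r * s)%N.
Proof. by rewrite -qE; have := finNzRing_gt1 F; case: #|F| => [|[]]. Qed.
Let r_gt0 : (0 < r)%N. Proof. by move: rs_gt0; rewrite muln_gt0 => /andP[]. Qed.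
Let s_gt0 : (0 < s)%N. Proof. by move: rs_gt0; rewrite muln_gt0 => /andP[]. Qed.
Let valV (u : V) : val u ^+ r = 1. Proof. exact/eqP/(valP u). Qed.
Let valV0 (u : V) : val u != 0.
Proof.
by apply/eqP => u0; have := valV u; rewrite u0 expr0n gtn_eqF// => /eqP; rewrite eq_sym oner_eq0.
Qed.
Let W_neq0 x : x != 0 -> W x != 0.
Proof. by move=> x0; rewrite -W0 (inj_eq W_inj). Qed.

Let oneV : V := exist (fun u : F => u ^+ r == 1) 1 (introT eqP (expr1n F r)).

(* [\sum_(i < r) (W x / W lam) ^ i] for [x] zero or an [r]-th root of unity,
   with the convention [0 ^ 0 = 1]. *)
Definition weight (x : F) (lam : V) : nat :=
  if x == 0 then 1 else if x == val lam then r else 0.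

Definition tuple_weight (x : V -> F) : nat := \sum_(lam : V) \prod_(u : V) weight (x u) lam.

Lemma sum_char_ratio (x : F) (lam : V) : x = 0 \/ x ^+ r = 1 ->
  \sum_(i < r) (W x * (W (val lam))^-1) ^+ i = (weight x lam)%:R.
Proof.
rewrite /weight; have [-> _|x0 [/eqP|xr]] := eqVneq x 0; [|by rewrite (negPf x0)|].
  rewrite W0 mul0r; case: r r_gt0 => // k _; rewrite big_ord_recl expr0 big1 ?addr0// => i _.
  by rewrite expr0n.
have Wl0 := W_neq0 (valV0 lam).
case: eqVneq => [->|xl].
  rewrite divff//; under eq_bigr => i _ do rewrite expr1n.
  by rewrite sumr_const card_ord.
set t := W x / _; have t1 : t - 1 != 0.
  rewrite subr_eq0; apply: contra xl => /eqP tE; apply/eqP/W_inj.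
  by rewrite -[LHS](divfK Wl0) -/t tE mul1r.
apply: (mulfI t1); rewrite -subrX1 mulr0 /t expr_div_n -!(char_exp W1 WM).
by rewrite xr valV W1 divr1 subrr.
Qed.

Lemma sum_unity_roots_char N :
  \sum_(lam : V) (W (val lam))^-1 ^+ N = if (r %| N)%N then r%:R else 0.
Proof.
case: ifP => rN.
  rewrite (eq_bigr (fun=> 1)) ?sumr_const ?cardV// => lam _.
  have /dvdnP[k ->] := rN.
  by rewrite exprVn -(char_exp W1 WM) mulnC exprM valV expr1n W1 invr1.
have [z zP] := finField_prim_root_exists F.
have yP : r.-primitive_root (z ^+ (#|F|.-1 %/ r)).
  by apply: (dvdn_prim_root zP); rewrite qE dvdn_mulr.
set y := z ^+ _ in yP.
have yr : y ^+ r = 1 := prim_expr_order yP.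
have mulVP (lam : V) : (y * val lam) ^+ r == 1 by rewrite exprMn yr valV mulr1.
pose my lam : V := exist (fun u : F => u ^+ r == 1) _ (mulVP lam).
have y0 : y != 0.
  by apply: contra_eq_neq yr => ->; rewrite expr0n gtn_eqF// eq_sym oner_eq0.
have my_inj : injective my by move=> a b /(congr1 val) /= /(mulfI y0) ab; apply: val_inj.
have Wy : (W y)^-1 ^+ N - 1 != 0.
  rewrite subr_eq0 exprVn -(inj_eq invr_inj) invrK invr1 -(char_exp W1 WM) -W1 (inj_eq W_inj).
  by rewrite -(prim_order_dvd yP) rN.
apply: (mulfI Wy); rewrite mulr0 mulrBl mul1r mulr_sumr [X in _ - X](reindex_inj my_inj) /=.
by apply/eqP; rewrite subr_eq0; apply/eqP/eq_bigr => lam _; rewrite WM invfM exprMn.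
Qed.

(** Every weight is a geometric sum. Expanding the product over [u] produces the tuples [J], and
    summing over [lam] kills those whose total is not divisible by [r]. *)
Lemma tuple_weight_char (x : V -> F) : (forall u, x u = 0 \/ x u ^+ r = 1) ->
  r%:R * \sum_(J : {ffun V -> 'I_r} | (r %| \sum_u J u)%N) \prod_u W (x u) ^+ J u
    = (tuple_weight x)%:R.
Proof.
move=> hx; rewrite /tuple_weight natr_sum.
under [RHS]eq_bigr => lam _.
  rewrite natr_prod; under eq_bigr => u _ do rewrite -sum_char_ratio//.
  rewrite bigA_distr_bigA; over.
rewrite exchange_big /= mulr_sumr big_mkcond; apply: eq_bigr => J _.
under [RHS]eq_bigr => lam _.
  under eq_bigr => u _ do rewrite exprMn.
  rewrite big_split /= -expr_sum; over.
rewrite -mulr_sumr sum_unity_roots_char mulrC.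
by case: ifP; rewrite ?mulr0// mulrC.
Qed.

Lemma tuple_weight_nonzero (x : V -> F) : (forall u, x u != 0) ->
  tuple_weight x = (r ^ r * #|[pred lam : V | [forall u, x u == val lam]]|)%N.
Proof.
move=> x0; rewrite /tuple_weight -sum1_card big_distrr [RHS]big_mkcond /=.
apply: eq_bigr => lam _; rewrite -topredE /=; case: ifP => [/forallP E|/forallPn[u xu]].
  rewrite muln1 -[X in (_ ^ X)%N]cardV -prod_nat_const; apply: eq_bigr => u _.
  by rewrite /weight (negPf (x0 u)) E.
by rewrite (bigD1 u)//= /weight (negPf (x0 u)) (negPf xu) mul0n.
Qed.

Lemma tuple_weight_one_zero (x : V -> F) (u0 : V) :
  x u0 = 0 -> (forall u, u != u0 -> x u != 0) ->
  tuple_weight x = (r ^ r.-1 * #|[pred lam : V | [forall (u | u != u0), x u == val lam]]|)%N.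
Proof.
move=> xu0 x0; rewrite /tuple_weight -sum1_card big_distrr [RHS]big_mkcond /=.
apply: eq_bigr => lam _; rewrite -topredE /= (bigD1 u0)//= {1}/weight xu0 eqxx mul1n.
case: ifP => [/forall_inP E|/negbT].
  rewrite muln1 (eq_bigr (fun=> r)).
    by rewrite prod_nat_const -[X in (_ ^ X.-1)%N]cardV -(cardC1 u0); congr (_ ^ _)%N; apply: eq_card.
  by move=> u uu0; rewrite /weight (negPf (x0 u uu0)) E.
rewrite negb_forall_in => /exists_inP[u uu0 xu].
by rewrite (bigD1 u)//= /weight (negPf (x0 u uu0)) (negPf xu) mul0n.
Qed.

Lemma card_constant_off (x : V -> F) (u0 : V) :
  (#|[pred lam : V | [forall (u | u != u0), x u == val lam]]| <= 1)%N.
Proof.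
apply/card_le1P => l1; rewrite inE => /forall_inP h1 l2; rewrite !inE.
apply/forall_inP/eqP => [h2|-> u /h1//].
apply: val_inj; case: (pickP [pred u | u != u0]) => [u /= uu0|all0].
  by rewrite -(eqP (h1 u uu0)) -(eqP (h2 u uu0)).
(* With no element besides [u0] the condition is void, but [V] is a singleton. *)
by have /negbFE/eqP-> := all0 l1; have /negbFE/eqP-> := all0 l2.
Qed.

Lemma card_constant (x : V -> F) :
  (#|[pred lam : V | [forall u, x u == val lam]]| <= 1)%N.
Proof.
apply: leq_trans (card_constant_off x oneV); apply: subset_leq_card.
by apply/subsetP => l; rewrite !inE => /forallP h; apply/forall_inP => u _.
Qed.

Let Js : pred {ffun V -> 'I_r} := fun J => (r %| \sum_u J u)%N.
Let supp (J : {ffun V -> 'I_r}) := #|[pred u | (J u : nat) != 0%N]|.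
Let J0 : {ffun V -> 'I_r} := [ffun=> Ordinal r_gt0].

(** The character identity itself does the counting: it is evaluated at the constant tuple 1, and
    below at the tuple with a single 0, where [0 ^ J u0] selects [J u0 = 0]. *)
Lemma card_balanced : (r * #|Js| = r ^ r)%N.
Proof.
have h : forall u : V, (1 : F) = 0 \/ (1 : F) ^+ r = 1 by move=> u; right; rewrite expr1n.
have := tuple_weight_char h; rewrite tuple_weight_nonzero => [|u]; last exact: oner_neq0.
rewrite (_ : #|_| = 1%N); last first.
  apply/eqP; rewrite eqn_leq (card_constant (fun=> 1)) /=; apply/card_gt0P.
  by exists oneV; rewrite inE; apply/forallP.
rewrite (eq_bigr (fun=> 1)); last by move=> J _; rewrite big1// => u _; rewrite W1 expr1n.
by rewrite sumr_const -natrM muln1 => /eqP; rewrite eqr_nat => /eqP.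
Qed.

Lemma card_balanced_vanishing (u0 : V) :
  (r * #|[pred J | Js J && ((J u0 : nat) == 0%N)]| = r ^ r.-1)%N.
Proof.
pose x (u : V) : F := if u == u0 then 0 else 1.
have h : forall u : V, x u = 0 \/ x u ^+ r = 1.
  by move=> u; rewrite /x; case: eqP => _; [left|right; rewrite expr1n].
have := tuple_weight_char h.
rewrite (@tuple_weight_one_zero x u0); last first.
- by move=> u uu0; rewrite /x (negPf uu0) oner_eq0.
- by rewrite /x eqxx.
rewrite (_ : #|[pred lam : V | _]| = 1%N); last first.
  apply/eqP; rewrite eqn_leq card_constant_off /=; apply/card_gt0P.
  by exists oneV; rewrite inE; apply/forall_inP => u uu0; rewrite /x (negPf uu0).
rewrite (eq_bigr (fun J : {ffun V -> 'I_r} => ((J u0 : nat) == 0%N)%:R)).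
  rewrite -natr_sum -natrM muln1 => /eqP; rewrite eqr_nat => /eqP <-; congr (_ * _)%N.
  rewrite -sum1_card big_mkcondr /=; apply: eq_bigr => J _; by case: eqP.
move=> J _; rewrite (bigD1 u0)//= [X in _ * X]big1 ?mulr1; last first.
  by move=> u uu0; rewrite /x (negPf uu0) W1 expr1n.
by rewrite /x eqxx W0 expr0n.
Qed.

Lemma sum_support : (r * \sum_(J | Js J) supp J + r ^ r = r * r ^ r)%N.
Proof.
have E : (\sum_(J | Js J) supp J = \sum_(u : V) #|[pred J | Js J && ((J u : nat) != 0%N)]|)%N.
  rewrite (eq_bigr (fun J : {ffun V -> 'I_r} => \sum_u ((J u : nat) != 0%N)))%N.
    rewrite exchange_big; apply: eq_bigr => u _; rewrite -sum1_card big_mkcondr /=.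
    by apply: eq_bigr => J _; case: eqP.
  by move=> J _; rewrite /supp -sum1_card big_mkcond; apply: eq_bigr => u _; rewrite inE; case: eqP.
have A (u : V) : (r * #|[pred J | Js J && ((J u : nat) != 0%N)]| + r ^ r.-1 = r ^ r)%N.
  rewrite -(card_balanced_vanishing u) -mulnDr -card_balanced; congr (_ * _)%N.
  rewrite -(cardID [pred J : {ffun V -> 'I_r} | (J u : nat) == 0%N] Js) addnC.
  by congr (_ + _)%N; apply: eq_card => J; rewrite !inE -topredE /= andbC.
rewrite E big_distrr /=.
have S2 : (\sum_(u : V) r ^ r.-1 = r ^ r)%N by rewrite sum_nat_const cardV -expnS prednK.
rewrite -{1}S2 -big_split /= (eq_bigr (fun=> r ^ r)%N) => [|u _]; last exact: A.
by rewrite sum_nat_const cardV.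
Qed.

Lemma support_gt1 J : Js J -> J != J0 -> (1 < supp J)%N.
Proof.
move=> JJ JJ0; have [u Ju] : exists u, (J u : nat) != 0%N.
  apply/existsP; apply: contraNT JJ0; rewrite negb_exists => /forallP H.
  by apply/eqP/ffunP => u; apply: val_inj; rewrite ffunE /=; apply/eqP; rewrite -[_ == _]negbK H.
rewrite ltnNge; apply/negP => /card_le1P le1.
have JE : (\sum_u J u = J u)%N.
  rewrite (bigD1 u)//= big1 ?addn0// => u' u'u; apply/eqP/negPn/negP => Ju'.
  have := le1 u; rewrite inE => /(_ Ju u'); rewrite !inE (negPf u'u) => E.
  by rewrite E in Ju'.
move: JJ; rewrite /Js JE => /dvdn_leq; rewrite lt0n Ju => /(_ isT).
by rewrite leqNgt ltn_ord.
Qed.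

(** The sum equals [(r - 3) r^(r-1) + 2]. Divided by [r^(r-1)], it accounts for both
    [(r - 3) sqrt q] and [2 sqrt q / r^(r-1)] in the theorem; the 2 comes from leaving out the zero
    tuple. *)
Lemma sum_excess :
  (r * \sum_(J | Js J && (J != J0)) (supp J - 2) + 3 * r ^ r = r * r ^ r + 2 * r)%N.
Proof.
have JJ0 : Js J0 by rewrite /Js big1 ?dvdn0// => u _; rewrite ffunE.
have supp0 : supp J0 = 0%N by apply: eq_card0 => u; rewrite inE ffunE.
have S1 : (\sum_(J | Js J) supp J = \sum_(J | Js J && (J != J0)) supp J)%N.
  by rewrite (bigD1 J0)//= supp0.
have S2 : (\sum_(J | Js J && (J != J0)) supp J =
   \sum_(J | Js J && (J != J0)) (supp J - 2) + 2 * (#|Js| - 1))%N.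
  have -> : (#|Js| - 1 = \sum_(J | Js J && (J != J0)) 1)%N.
    by rewrite -sum1_card (bigD1 J0)//= addKn.
  rewrite big_distrr -big_split /=; apply: eq_bigr => J /andP[JJ JnJ0].
  by rewrite muln1 subnK// support_gt1.
have Js_gt0 : (0 < #|Js|)%N by apply/card_gt0P; exists J0.
have := sum_support; rewrite S1 S2 -card_balanced.
move: #|Js| Js_gt0 => N; move: (\sum_(J | _) _)%N => X; case: N => // N _.
by rewrite subSS subn0; nia.
Qed.

Let excess := (\sum_(J | Js J && (J != J0)) (supp J - 2))%N.
Let bf := @binomial_factor F r s e.
Let q := #|F|.

Let u_exp_inj : injective (fun u : V => val u ^+ e).
Proof.
move=> u u' E; apply: val_inj; apply: (divIf (valV0 u')); rewrite divff//.
apply: (expr_coprime_eq1 r_gt0 (_ : coprime r e)).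
- by rewrite coprime_sym.
- by rewrite expr_div_n !valV divr1.
- by rewrite expr_div_n E divff// expf_neq0.
Qed.

Let bf_eq0 a u : (bf a u == 0) = (val u ^+ e + a == 0).
Proof. by rewrite /bf /binomial_factor expf_eq0 s_gt0. Qed.

Let bf_unity a u : bf a u = 0 \/ bf a u ^+ r = 1.
Proof.
rewrite /bf /binomial_factor; have [->|h0] := eqVneq (val u ^+ e + a) 0.
  by left; rewrite expr0n gtn_eqF.
by right; have := expf_card_pred h0; rewrite qE mulnC exprM.
Qed.

Lemma sum_tuple_weight_regular (c : V -> F) : (forall u, c u ^+ r = 1) ->
  (\sum_(a | [forall u : V, bf a u != 0%R]) tuple_weight (fun u => (bf a u / c u)%R) =
   r ^ r * twisted_count s e c)%N.
Proof.
move=> c1; have c0 u : c u != 0.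
  by apply: contra_eq_neq (c1 u) => ->; rewrite expr0n gtn_eqF// eq_sym oner_eq0.
pose m a := #|[pred lam : V | [forall u : V, bf a u == val lam * c u]]|.
transitivity (\sum_(a | [forall u : V, bf a u != 0%R]) r ^ r * m a)%N.
  apply: eq_bigr => a /forallP nz; rewrite tuple_weight_nonzero.
    congr (_ * _)%N; apply: eq_card => lam; rewrite !inE; apply: eq_forallb => u.
    by rewrite -(inj_eq (mulIf (c0 u))) divfK.
  by move=> u; rewrite mulf_neq0 ?invr_eq0.
rewrite -big_distrr; congr (_ * _)%N => /=.
rewrite big_mkcond (eq_bigr m) => [|a _]; last first.
  case: ifP => // /negbT/forallPn[u]; rewrite negbK => bu.
  apply/esym/eq_card0 => lam; rewrite inE; apply/negbTE/forallPn; exists u.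
  by rewrite (eqP bu) eq_sym mulf_neq0.
rewrite /m /twisted_count.
under eq_bigr => a _ do rewrite -sum1_card big_mkcond.
rewrite exchange_big; apply: eq_bigr => lam _; rewrite -sum1_card [RHS]big_mkcond.
by apply: eq_bigr => a _.
Qed.

(** At most [r] values [a] are irregular. As the [u^e] are distinct, each makes exactly one
    coordinate vanish and has weight at most [r^(r-1)]. *)
Lemma sum_tuple_weight_irregular (c : V -> F) : (forall u, c u ^+ r = 1) ->
  (\sum_(a | ~~ [forall u : V, bf a u != 0%R]) tuple_weight (fun u => (bf a u / c u)%R) <= r ^ r)%N.
Proof.
move=> c1; have c0 u : c u != 0.
  by apply: contra_eq_neq (c1 u) => ->; rewrite expr0n gtn_eqF// eq_sym oner_eq0.
apply: (@leq_trans (\sum_(a | ~~ [forall u : V, bf a u != 0%R]) r ^ r.-1)%N).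
  apply: leq_sum => a /forallPn[u0]; rewrite negbK => bu0.
  rewrite (@tuple_weight_one_zero _ u0).
  - by rewrite -[X in (_ <= X)%N]muln1 leq_mul2l card_constant_off orbT.
  - by rewrite (eqP bu0) mul0r.
  move=> u uu0; rewrite mulf_neq0 ?invr_eq0// bf_eq0.
  apply: contra uu0 => /eqP bu; apply/eqP/u_exp_inj.
  by move: bu0; rewrite bf_eq0 => /eqP bu0; apply: (addIr a); rewrite bu bu0.
have -> : (r ^ r = r * r ^ r.-1)%N by rewrite -expnS prednK.
rewrite sum_nat_const leq_mul2r; apply/orP; right.
rewrite -[X in (_ <= X)%N]cardV -(card_codom (f := fun u : V => - (val u ^+ e))).
  apply: subset_leq_card; apply/subsetP => a; rewrite -!topredE /= => /forallPn[u].
  rewrite negbK bf_eq0 addrC addr_eq0 => /eqP ->; exact: codom_f.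
by move=> u u' /oppr_inj/u_exp_inj.
Qed.

(* [E] collects the contributions of the ramified values [a = - u ^ e] and of
   [a = infinity]. *)
Lemma twisted_count_estimate (c : V -> F) : (forall u, c u ^+ r = 1) ->
  exists2 E : nat, (E <= 2 * r ^ r)%N &
    `|(r ^ r * twisted_count s e c + E)%:R - (r * q.+1)%:R : algC|
      <= (r * excess)%:R * sqrtC q%:R.
Proof.
move=> c1; have c0 u : c u != 0.
  by apply: contra_eq_neq (c1 u) => ->; rewrite expr0n gtn_eqF// eq_sym oner_eq0.
pose Eirr := (\sum_(a | ~~ [forall u : V, bf a u != 0%R]) tuple_weight (fun u => (bf a u / c u)%R))%N.
pose Einf := tuple_weight (fun u => (c u)^-1).
have cV1 u : (c u)^-1 ^+ r = 1 by rewrite exprVn c1 invr1.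
exists (Eirr + Einf)%N.
  rewrite mul2n -addnn leq_add ?sum_tuple_weight_irregular//.
  rewrite /Einf tuple_weight_nonzero => [|u]; last by rewrite invr_eq0.
  by rewrite -[X in (_ <= X)%N]muln1 leq_mul2l card_constant orbT.
pose kap (J : {ffun V -> 'I_r}) := \prod_u W (c u)^-1 ^+ J u.
pose S (J : {ffun V -> 'I_r}) := \sum_a \prod_u W (bf a u) ^+ J u.
have totalE : (r ^ r * twisted_count s e c + (Eirr + Einf))%:R =
    r%:R * \sum_(J | Js J) kap J * (1 + S J) :> algC.
  rewrite addnA (_ : (r ^ r * twisted_count s e c + Eirr =
    \sum_a tuple_weight (fun u => (bf a u / c u)%R))%N); last first.
    by rewrite -sum_tuple_weight_regular// [RHS](bigID (fun a => [forall u : V, bf a u != 0%R])).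
  rewrite natrD natr_sum.
  rewrite /Einf -tuple_weight_char; last by move=> u; right.
  under eq_bigr => a _.
    rewrite -tuple_weight_char; last first.
      move=> u; rewrite expr_div_n c1 divr1.
      by case: (bf_unity a u) => ->; [left; rewrite mul0r|right].
    over.
  rewrite -mulr_sumr -mulrDr exchange_big -big_split; congr (_ * _) => /=.
  apply: eq_bigr => J _; rewrite mulrDr mulr1 addrC; congr (_ + _).
  rewrite mulr_sumr; apply: eq_bigr => a _; rewrite -big_split /=.
  by apply: eq_bigr => u _; rewrite WM exprMn mulrC.
have JJ0 : Js J0 by rewrite /Js big1 ?dvdn0// => u _; rewrite ffunE.
rewrite totalE (bigD1 J0)//= mulrDr.
(* The zero tuple yields the main term, the number of points of the projective line. *)
have -> : kap J0 * (1 + S J0) = q.+1%:R.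
  rewrite /kap big1 => [|u _]; last by rewrite ffunE expr0.
  rewrite /S (eq_bigr (fun=> 1)); last by move=> a _; rewrite big1// => u _; rewrite ffunE expr0.
  by rewrite sumr_const mul1r -[q.+1]add1n natrD.
rewrite -natrM [X in X - _]addrC addrK normrM normr_nat natrM -mulrA ler_wpM2l ?ler0n//.
apply: (le_trans (ler_norm_sum _ _ _)).
rewrite /excess natr_sum mulr_suml; apply: ler_sum => J /andP[JJ JnJ0].
rewrite normrM (_ : `|kap J| = 1) ?mul1r; last first.
  rewrite normr_prod big1// => u _; rewrite normrX (norm_char W1 WM) ?expr1n// invr_eq0//.
pose A : {pred V} := [pred u | (J u : nat) != 0%N].
pose I : finType := {u in A}.
have cardI : #|I| = supp J by rewrite card_sig; apply: eq_card => u; rewrite !inE.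
pose b (i : I) : F := val (val i) ^+ e.
pose j (i : I) := (s * J (val i))%N.
(* Replacing [a] by [-a] gives the form required by [weil_bound]; only the support of [J]
   contributes factors. *)
have -> : S J = \sum_a \prod_(i : I) W (b i - a) ^+ j i.
  rewrite /S (reindex_inj oppr_inj) /=; apply: eq_bigr => a _.
  rewrite (bigID (mem A))/= [X in _ * X]big1 ?mulr1; last first.
    by move=> u; rewrite inE negbK => /eqP ->; rewrite expr0.
  rewrite (big_sub A); apply: eq_bigr => i _.
  by rewrite /bf /binomial_factor (char_exp W1 WM) -exprM.
rewrite -cardI; apply: weil_bound => //.
- by move=> i i' /u_exp_inj /val_inj.
- by move=> i; rewrite expf_neq0.
- move=> i; rewrite qE /j mulnC dvdn_pmul2l//; apply/negP => /dvdn_leq.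
  have Ji : (J (val i) : nat) != 0%N by exact: (valP i).
  by rewrite lt0n Ji leqNgt ltn_ord => /(_ isT).
- rewrite qE /j -big_distrr mulnC dvdn_pmul2l//=.
  rewrite -(big_sub A (fun u => J u : nat)) big_mkcond /=.
  move: JJ; rewrite /Js; congr (_ %| _)%N; apply: eq_bigr => u _.
  by rewrite inE; case: eqP => //= ->.
by rewrite cardI (ltn_trans _ (support_gt1 JJ JnJ0)).
Qed.

Lemma twisted_count_bound : exists2 X : nat,
  (r * X + 3 * r ^ r = r * r ^ r + 2 * r)%N &
  forall c : V -> F, (forall u, c u ^+ r = 1) ->
  exists2 E : nat, (E <= 2 * r ^ r)%N &
    `|(r ^ r * twisted_count s e c + E)%:R - (r * q.+1)%:R : algC|
      <= (r * X)%:R * sqrtC q%:R.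
Proof. by exists excess; [exact: sum_excess|exact: twisted_count_estimate]. Qed.

End TupleCount.

(** * From algebraic numbers to the real bounds on T *)

(** Squaring turns both inequalities into the same inequality between integers. *)
Lemma natr_dist_le_sqrt (R : realType) (a b v q : nat) :
  `|a%:R - b%:R : algC| <= v%:R * sqrtC q%:R ->
  `|a%:R - b%:R : R| <= v%:R * Num.sqrt q%:R.
Proof.
move=> H.
have : (`|a%:R - b%:R : algC| ^+ 2 <= (v%:R * sqrtC q%:R) ^+ 2).
  by rewrite ler_pXn2r// nnegrE mulr_ge0 ?ler0n// sqrtC_ge0 ler0n.
rewrite exprMn sqrtCK real_normK; last by rewrite rpredB ?realn.
have toint (S : numDomainType) : ((a%:R - b%:R) ^+ 2 <= v%:R ^+ 2 * q%:R :> S) =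
    ((a%:Z - b%:Z) ^+ 2 <= v%:Z ^+ 2 * q%:Z).
  rewrite -(ler_int S) rmorphXn rmorphB rmorphM rmorphXn /=.
  by rewrite -!pmulrn.
rewrite toint -(toint R) => H2.
rewrite -(@ler_pXn2r _ 2)// ?nnegrE ?mulr_ge0 ?ler0n ?sqrtr_ge0 ?normr_ge0//.
by rewrite exprMn sqr_sqrtr ?ler0n// real_normK ?num_real.
Qed.

Lemma card_perm_type (T : finType) : #|{perm T}| = #|T|`!.
Proof.
rewrite -(cardsT T) -card_perm; apply: eq_card => p; rewrite !inE.
by apply/esym/subsetP => x _; rewrite inE.
Qed.

(** [T / (r - 1)!] is the average of [twisted_count] over the [r!] permutations of the roots of
    unity, so a bound for each permutation suffices. The error [E] lies between 0 and [2 r^r] and is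
    subtracted, hence the [- 2] in the lower bound alone. *)
Lemma permutation_count_bounds (R : realType) (F : finFieldType) (r s e n : nat) :
  #|F|.-1 = (r * s)%N -> coprime e r -> coprime n s -> (0 < n)%N -> (0 < r)%N ->
  let T := num_permuting F (n + e * s) n in
  let q : R := #|F|%:R in
  let sq := Num.sqrt q in
  (q - 2 * sq + 1) / r%:R ^+ (r - 1) - (r%:R - 3) * sq - 2
     <= T%:R / ((r - 1)`!)%:R /\
  T%:R / ((r - 1)`!)%:R
     <= (q + 2 * sq + 1) / r%:R ^+ (r - 1) + (r%:R - 3) * sq.
Proof.
move=> qE e_cop n_cop n_gt0 r_gt0 T q sq.
have TE : T = #|good (F := F) r s e n|.
  rewrite /T /num_permuting; apply: eq_card => a; rewrite !inE -[RHS]topredE /=; apply/asboolP/idP.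
    by move/(permutes_good e qE n_cop n_gt0).
  by move/(permutes_good e qE n_cop n_gt0).
have [W [W0 W1 WM W_inj]] := mult_char_exists F.
have [X XE bnd] := twisted_count_bound qE e_cop W0 W1 WM W_inj.
have := count_good e n qE; rewrite -TE => rT.
have cardV := card_unity_roots qE.
pose V : finType := {u : F | u ^+ r == 1}.
rewrite -/V in bnd rT cardV.
pose rho : R := (r ^ r)%:R; have rho0 : 0 < rho by rewrite ltr0n expn_gt0 r_gt0.
have rR0 : 0 < r%:R :> R by rewrite ltr0n.
pose B := (r%:R * X%:R) * sq.
have Mb (pi : {perm V}) :
   r%:R * (q + 1) - B - 2 * rho <= rho * (twisted_count s e (fun u => val (pi u) / val u ^+ n))%:R
     <= r%:R * (q + 1) + B.
  have c1 (u : V) : (val (pi u) / val u ^+ n) ^+ r = 1.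
    have vV (v : V) : val v ^+ r = 1 by apply/eqP; exact: (valP v).
    by rewrite expr_div_n exprAC !vV expr1n divr1.
  have [E E_le /(@natr_dist_le_sqrt R)] := bnd _ c1.
  rewrite ler_norml natrD !natrM -/rho -/q -/sq -[(#|F|.+1)]addn1 natrD -/q.
  have : E%:R <= 2 * rho by rewrite /rho -natrM ler_nat.
  have : 0 <= E%:R :> R by apply: ler0n.
  by rewrite /B; move=> h1 h2 /andP[h3 h4]; apply/andP; split; lra.
have permE : #|{perm V}|%:R = r%:R * ((r - 1)`!)%:R :> R.
  by rewrite card_perm_type cardV -natrM subn1 -[X in X`!](prednK r_gt0) factS prednK.
set f : R := ((r - 1)`!)%:R in permE *.
have f0 : 0 < f by rewrite ltr0n fact_gt0.
have sumE : rho * (r%:R * T%:R) =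
    \sum_(pi : {perm V}) rho * (twisted_count s e (fun u => val (pi u) / val u ^+ n))%:R.
  by rewrite -mulr_sumr -natr_sum -rT natrM.
have XR : r%:R * X%:R + 3 * rho = r%:R * rho + 2 * r%:R :> R.
  by rewrite /rho -!natrM -!natrD XE.
have rhoE : rho = r%:R * r%:R ^+ (r - 1).
  by rewrite /rho natrX -exprS subn1 prednK.
set p : R := r%:R ^+ (r - 1) in rhoE *.
have p0 : 0 < p by rewrite exprn_gt0.
have upper : rho * (r%:R * T%:R) <= r%:R * f * (r%:R * (q + 1) + B).
  rewrite sumE -permE mulr_natl -sumr_const; apply: ler_sum => pi _.
  by have /andP[] := Mb pi.
have lower : r%:R * f * (r%:R * (q + 1) - B - 2 * rho) <= rho * (r%:R * T%:R).
  rewrite sumE -permE mulr_natl -sumr_const; apply: ler_sum => pi _.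
  by have /andP[] := Mb pi.
have BE : B = r%:R * ((r%:R * p + 2 - 3 * p) * sq).
  rewrite /B (_ : r%:R * X%:R = r%:R * rho + 2 * r%:R - 3 * rho); last by rewrite -XR addrK.
  by rewrite rhoE; ring.
have pT : p * T%:R <= f * ((q + 1) + (r%:R * p + 2 - 3 * p) * sq).
  rewrite -(ler_pM2l (mulr_gt0 rR0 rR0)); move: upper; rewrite rhoE BE.
  by move=> h; apply: le_trans (le_trans h _); rewrite le_eqVlt; apply/orP; left; apply/eqP; ring.
have pT' : f * ((q + 1) - (r%:R * p + 2 - 3 * p) * sq - 2 * p) <= p * T%:R.
  rewrite -(ler_pM2l (mulr_gt0 rR0 rR0)); move: lower; rewrite rhoE BE.
  by move=> h; apply: le_trans (le_trans h _); rewrite le_eqVlt; apply/orP; left; apply/eqP; ring.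
split.
  rewrite ler_pdivlMr// -(ler_pM2l p0); apply: le_trans pT'.
  by rewrite le_eqVlt; apply/orP; left; apply/eqP; field; rewrite gt_eqF.
rewrite ler_pdivrMr// -(ler_pM2l p0); apply: le_trans pT _.
by rewrite le_eqVlt; apply/orP; left; apply/eqP; field; rewrite gt_eqF.
Qed.

(** * Existence of a permutation binomial *)

(** This rational bound allows a lower bound [i / k] for a logarithm to be certified by comparing
    integer powers. *)
Lemma expR_inv_leq (R : realType) (k : nat) : (1 < k)%N ->
  sequences.expR (k%:R^-1 : R) <= k%:R / (k%:R - 1).
Proof.
move=> k_gt1; have k1 : 0 < k%:R - 1 :> R by rewrite subr_gt0 ltr1n.
have k0 : 0 < k%:R :> R by rewrite ltr0n ltnW.
have := expR_ge1Dx (- (k%:R^-1) : R); rewrite expRN => h.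
rewrite -[sequences.expR _]invrK -[_ / _]invrK invf_div lef_pV2 ?posrE ?divr_gt0 ?invr_gt0 ?expR_gt0//.
by apply: le_trans h; rewrite mulrBl divff ?gt_eqF// mul1r.
Qed.

Lemma expR_ratio_leq_ln (R : realType) (k i : nat) (x : R) : (1 < k)%N -> 0 < x ->
  (k%:R / (k%:R - 1)) ^+ i <= x -> i%:R / k%:R <= ln x.
Proof.
move=> k_gt1 x0 h; rewrite -ler_expR lnK// expRM_natl; apply: le_trans h.
apply: lerXn2r; rewrite ?nnegrE ?expR_ge0 ?expR_inv_leq//.
by rewrite divr_ge0 ?ler0n// subr_ge0 ler1n ltnW.
Qed.

Lemma leq_ln_nat (R : realType) (k i q : nat) : (0 < k)%N -> (0 < q)%N ->
  (k.+1 ^ i <= q * k ^ i)%N -> i%:R / k.+1%:R <= ln (q%:R : R).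
Proof.
move=> k_gt0 q_gt0 h; apply: expR_ratio_leq_ln; rewrite ?ltr0n//.
rewrite -[k.+1]addn1 natrD addrK -natrD addn1 expr_div_n ler_pdivrMr ?exprn_gt0 ?ltr0n//.
by rewrite -!natrX -natrM ler_nat.
Qed.

Lemma ln_geq (R : realType) (x : R) : 0 < x -> 1 - x^-1 <= ln x.
Proof.
move=> x0; rewrite -ler_expR lnK//; have := expR_ge1Dx (- (1 - x^-1)).
rewrite expRN opprB addrC subrK => h.
by rewrite -[sequences.expR _]invrK -[leRHS]invrK lef_pV2 ?posrE ?invr_gt0 ?expR_gt0.
Qed.

(** Certificates for [ln 4 >= 20/15], [ln 5 >= 14/10] and [ln 6 >= 17/10]. *)
Lemma power_ratio_bounds (q : nat) :
  [/\ 4 <= q -> 15 ^ 20 <= q * 14 ^ 20, 5 <= q -> 10 ^ 14 <= q * 9 ^ 14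
    & 6 <= q -> 10 ^ 17 <= q * 9 ^ 17]%N.
Proof. by split; lia. Qed.

(* If [u = ln q < r], then [ln u < 1 / 2], which leaves [q = 4] and [q = 5]; these
   are excluded by [ln u >= 1 - 1 / u]. *)
Lemma ratio_le_ln (R : realType) (q r : nat) :
  (4 <= q)%N -> (2 <= r)%N ->
  2 * r%:R * ln (ln (q%:R : R)) < ln q%:R * (1 - q%:R^-1) -> r%:R <= ln (q%:R : R).
Proof.
move=> q4 r2; set u := ln q%:R => h.
have r2R : 2 <= r%:R :> R by rewrite ler_nat.
have q0 : (0 < q)%N by apply: leq_trans q4.
have u43 : 4 / 3 <= u.
  have : 20%:R / 15%:R <= u.
    by apply: leq_ln_nat => [//|//|]; have [+ _ _] := power_ratio_bounds q; apply.
  by lra.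
rewrite leNgt; apply/negP => ur.
have u0 : 0 < u by lra.
have lnu0 : 1 - u^-1 <= ln u := ln_geq u0.
have uV : u * u^-1 = 1 by rewrite divff ?gt_eqF.
have lnu_gt0 : 0 < ln u.
  by apply: lt_le_trans lnu0; rewrite subr_gt0 invf_lt1//; lra.
have qV : 0 < q%:R^-1 :> R by rewrite invr_gt0 ltr0n.
have lnu2 : ln u < 1 / 2.
  have : u * ln u <= r%:R * ln u by rewrite ler_pM2r// ltW.
  nra.
(* [(10/9)^5 < 17/10], so [u >= 17/10] would give [ln u >= 1/2]. *)
have u17 : u < 17 / 10.
  rewrite ltNge; apply/negP => u17; have : 5%:R / 10%:R <= ln u.
    apply: expR_ratio_leq_ln => //.
    have -> : 10%:R / (10%:R - 1) = 10 / 9 :> R by congr (_ / _); lra.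
    by rewrite !exprS expr0; lra.
  by lra.
have q6 : (q < 6)%N.
  rewrite ltnNge; apply/negP => q6.
  have : 17%:R / 10%:R <= u.
    by apply: leq_ln_nat => [//|//|]; have [_ _ +] := power_ratio_bounds q; apply.
  by lra.
have main : 4 * (u - 1) < u ^+ 2 * (1 - q%:R^-1).
  have h1 : 2 * 2 * (1 - u^-1) <= 2 * r%:R * ln u.
    apply: (@le_trans _ _ (2 * 2 * ln u)); first by lra.
    by apply: ler_wpM2r; [exact: ltW|lra].
  have h2 : 2 * 2 * (1 - u^-1) < u * (1 - q%:R^-1) by apply: le_lt_trans h1 h.
  have : u * (2 * 2 * (1 - u^-1)) < u * (u * (1 - q%:R^-1)) by rewrite ltr_pM2l.
  rewrite mulrBr mulr1 mulrBr [u * (_ * u^-1)]mulrCA uV; lra.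
(* For [q = 4] the quadratic inequality [main] has roots 4/3 and 4 and fails between them, so
   [u >= 4/3] is exactly what is needed; for [q = 5] its smaller root lies below 14/10. *)
have [q4' | q5] : (q = 4 \/ q = 5)%N by move: q4 q6; clear; lia.
  move: main; rewrite q4'; nra.
have u14 : 14%:R / 10%:R <= u.
  by apply: leq_ln_nat => [//|//|]; have [_ + _] := power_ratio_bounds q; apply; rewrite q5.
by move: main; rewrite q5; nra.
Qed.

(** With [s = (q - 1)/r] the hypothesis reads [2 r ln ln q < (1 - 1/q) ln q]. Once [r <= ln q] is
    known, [ln r <= ln ln q] turns this into [2 r ln r < ln q]. *)
Lemma self_power_lt_sqrt (R : realType) (q r s : nat) :
  (4 <= q)%N -> (2 <= r)%N -> (q - 1 = r * s)%N ->
  2 * q%:R * ln (ln (q%:R : R)) / ln (q%:R : R) < s%:R ->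
  r%:R ^+ r < Num.sqrt q%:R :> R.
Proof.
move=> q4 r2 qE; set u := ln q%:R; set L := ln u => h.
have q0 : (0 < q)%N by apply: leq_trans q4.
have qR0 : 0 < q%:R :> R by rewrite ltr0n.
have r0 : 0 < r%:R :> R by rewrite ltr0n (leq_trans _ r2).
have u0 : 0 < u by apply: ln_gt0; rewrite ltr1n (leq_trans _ q4).
have h1 : 2 * r%:R * L < u * (1 - q%:R^-1).
  move: h; rewrite ltr_pdivrMr// => h.
  have qEr : r%:R * s%:R = q%:R - 1 :> R by rewrite -natrM -qE natrB.
  rewrite -(ltr_pM2l qR0).
  have -> : q%:R * (u * (1 - q%:R^-1)) = r%:R * (s%:R * u).
    rewrite [RHS]mulrA qEr mulrCA mulrBr mulr1 divff ?gt_eqF//. by rewrite mulrC.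
  have -> : q%:R * (2 * r%:R * L) = r%:R * (2 * q%:R * L) by ring.
  by rewrite ltr_pM2l.
have ru := ratio_le_ln q4 r2 h1.
have lnr : ln r%:R <= L by rewrite ler_ln.
have : r%:R ^+ (2 * r) < q%:R :> R.
  rewrite -ltr_ln ?posrE ?exprn_gt0// lnXn// -[X in X < _]mulr_natl natrM.
  apply: (@le_lt_trans _ _ (2 * r%:R * L)); first by rewrite ler_pM2l ?mulr_gt0.
  apply: lt_le_trans h1 _; apply: ler_piMr; [exact: ltW|by rewrite gerBl invr_ge0 ltW].
rewrite mulnC exprM -{1}(@sqr_sqrtr _ q%:R) ?ltW// ltr_pXn2r// nnegrE ?sqrtr_ge0//.
by rewrite exprn_ge0 ?ltW.
Qed.

(** Here [y] is [sqrt q]. After multiplication by [p = r^(r-1)], the term [y^2] exceeds [r p y], and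
    the remaining [3 p (y - 1) - 2 y + 1] is positive because [p] and [y] are at least 2. *)
Lemma count_lower_bound_gt1 (R : realType) (r : nat) (y : R) :
  (2 <= r)%N -> 2 <= y -> r%:R ^+ r < y ->
  1 < (y ^+ 2 - 2 * y + 1) / r%:R ^+ (r - 1) - (r%:R - 3) * y - 2.
Proof.
move=> r2 y2; have r0 : 0 < r%:R :> R by rewrite ltr0n (leq_trans _ r2).
have r2R : 2 <= r%:R :> R by rewrite ler_nat.
have rE : (r = (r - 1).+1)%N by rewrite subn1 prednK// (leq_trans _ r2).
set p := r%:R ^+ (r - 1).
have -> : r%:R ^+ r = r%:R * p :> R by rewrite -exprS -rE.
move=> py.
have p0 : 0 < p by rewrite exprn_gt0.
have p2 : 2 <= p.
  apply: (@le_trans _ _ r%:R) => //; rewrite /p rE subn1 /=.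
  by case: r r2 {rE r0 r2R p p0 py} => [|[|r]]// _; rewrite exprS ler_peMr ?exprn_ege1 ?ler1n.
suff : (r%:R - 3) * y + 3 < (y ^+ 2 - 2 * y + 1) / p by lra.
rewrite ltr_pdivlMr//.
have y0 : 0 < y by lra.
have h1 : r%:R * p * y < y * y by rewrite ltr_pM2r.
have h2 : 0 <= (p - 2) * (y - 1) by apply: mulr_ge0; lra.
by rewrite expr2; nra.
Qed.

Theorem theorem1p5 (R : realType) (F : finFieldType) (q m n : nat)
    (hF : #|F| = q) (hq : (4 <= q)%N) (hn : (0 < n)%N) (hnm : (n < m)%N)
    (hgcd : gcdn (gcdn m n) (q - 1) = 1%N) :
  (2 * q%:R * ln (ln (q%:R : R)) / ln (q%:R : R)
     < (gcdn (m - n) (q - 1))%:R ->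
   exists a : F, a != 0 /\ permutes ('X^m + a *: 'X^n)) /\
  (let T := num_permuting F m n in
   let r := ((q - 1) %/ gcdn (m - n) (q - 1))%N in
   let sq : R := Num.sqrt q%:R in
   (q%:R - 2 * sq + 1) / r%:R ^+ (r - 1) - (r%:R - 3) * sq - 2
     <= T%:R / ((r - 1)`!)%:R
   /\
   T%:R / ((r - 1)`!)%:R
     <= (q%:R + 2 * sq + 1) / r%:R ^+ (r - 1) + (r%:R - 3) * sq).
Proof.
set s := gcdn (m - n) (q - 1); pose r := ((q - 1) %/ s)%N; rewrite /= -/r.
have q1_gt0 : (0 < q - 1)%N by rewrite subn_gt0 (leq_trans _ hq).
have s_gt0 : (0 < s)%N by rewrite gcdn_gt0 q1_gt0 orbT.
have qE : (q - 1 = r * s)%N by rewrite divnK// dvdn_gcdr.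
have r_gt0 : (0 < r)%N by rewrite divn_gt0// dvdn_leq// dvdn_gcdr.
pose e := ((m - n) %/ s)%N.
have mE : m = (n + e * s)%N by rewrite divnK ?dvdn_gcdl// subnKC// ltnW.
have e_cop : coprime e r.
  by rewrite /coprime -(eqn_pmul2r s_gt0) muln_gcdl mul1n -qE divnK ?dvdn_gcdl.
have n_cop : coprime n s.
  rewrite /coprime -dvdn1 -hgcd !dvdn_gcd dvdn_gcdl andbT.
  rewrite (dvdn_trans (dvdn_gcdr _ _) (dvdn_gcdr _ _)) andbT.
  by rewrite mE dvdn_addr ?dvdn_gcdl// dvdn_mull ?dvdn_gcdr.
have FqE : #|F|.-1 = (r * s)%N by rewrite hF -subn1.
have bounds := permutation_count_bounds R FqE e_cop n_cop hn r_gt0.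
rewrite /= hF -mE in bounds; split=> // hs.
(* One permuting value is not enough, since it could be [a = 0]. *)
have T_gt1 : (1 < num_permuting F m n)%N.
  have [lower _] := bounds.
  have [r1|r2] := leqP r 1%N.
    (* For [r = 1] the square roots cancel and the lower bound is [q - 1]. *)
    have rE : r = 1%N by apply/eqP; rewrite eqn_leq r1.
    move: lower; rewrite rE subnn expr0 !divr1 -(ltr_nat R).
    have : 4 <= q%:R :> R by rewrite ler_nat.
    lra.
  have y0 : 0 <= q%:R :> R by apply: ler0n.
  have y2 : 2 <= Num.sqrt q%:R :> R.
    rewrite -(@ler_pXn2r _ 2)// ?nnegrE ?sqrtr_ge0// sqr_sqrtr//.
    by apply: (@le_trans _ _ 4%:R); [lra|rewrite ler_nat].
  have := count_lower_bound_gt1 r2 y2 (self_power_lt_sqrt hq r2 qE hs).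
  rewrite sqr_sqrtr// => /lt_le_trans/(_ lower).
  rewrite ltr_pdivlMr ?ltr0n ?fact_gt0// mul1r ltr_nat => lt.
  by apply: leq_ltn_trans lt; apply: fact_gt0.
have /card_gt1P[a [b [aT bT ab]]] := T_gt1.
have [a0|a0] := eqVneq a 0; last by exists a; split=> //; move: aT; rewrite inE => /asboolP.
exists b; split; first by rewrite -a0 eq_sym.
by move: bT; rewrite inE => /asboolP.
Qed.
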